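(* Let $\lambda$ be a Ferrers shape and let $k$ be a positive integer. The explicit map $\Phi$ described in the context is a (well-defined) bijection from the set $\mathcal{F}_{NE}(\lambda,k)$ of $k$-north-east fillings of $\lambda$ to the set $\mathcal{F}_{SE}(\lambda,k)$ of $k$-south-east fillings of $\lambda$.
   Context: **Conventions.** Boxes are $(\text{row},\text{column})$, rows numbered from top to bottom and columns from left to right. A Ferrers shape $\lambda=(\lambda_1\ge\lambda_2\ge\cdots)$ is the set of boxes $(i,j)$ with $1\le j\le\lambda_i$. **Fillings.** A north-east (resp. south-east) chain of length $\ell$ in $\lambda$ is a sequence of $\ell$ boxes of $\lambda$ such that each box is strictly north (resp. south) and strictly east of the preceding one, and the smallest rectangle containing all boxes of the sequence is contained in $\lambda$. A $k$-north-east (resp. $k$-south-east) filling of $\lambda$ is a $(0,1)$-filling of $\lambda$ containing no north-east (resp. south-east) chain of $1$'s of length $k+1$ and in which the number of $1$'s is maximal. A filling is identified with its set of boxes filled with $1$. **The map $\Phi$.** Let $\mu$ be the Ferrers shape obtained from $\lambda$ by removing its first $k$ rows and first $k$ columns; regard box $(i,j)$ of $\mu$ as sitting at position $(i+k,j+k)$ in $\lambda$. Let $F\in\mathcal{F}_{NE}(\lambda,k)$. 1. Let $D=\lambda\setminus F$. 2. *Reading biword.* List the boxes $(r,c)$ of $D$ row by row from top to bottom, and within each row from right to left, and write the column $\binom{r}{r+c-1}$ for each. This gives $\binom{a_1\cdots a_\ell}{b_1\cdots b_\ell}$. 3. *Column Edelman--Greene insertion.* Insert $b_1,\dots,b_\ell$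 successively into an initially empty tableau. To insert $x$ into a column (starting with the first column): if no entry of the column is larger than $x$, put $x$ at the bottom of the column and stop. Otherwise let $y$ be the smallest entry larger than $x$. If $y=x+1$ and $x$ is already in the column, leave the column unchanged and insert $x+1$ into the next column; otherwise replace $y$ by $x$ and insert $y$ into the next column. When the insertion of $b_s$ creates a new box, record $a_s$ in the same position of the recording tableau. The resulting recording tableau $Q$ has shape $\mu$ and is a $k$-flagged tableau: a semistandard tableau (rows weakly, columns strictly increasing, positive integer entries) whose entries in row $i$ are $\le i+k$. 4. Let $R(i,j)=Q(i,j)-i$ for $(i,j)\in\mu$; the entries of $R$ lie in $\{0,\dots,k\}$ and increase weakly along rows and down columns. 5. If $\mu\neq\emptyset$, for $s=1,\dots,k$ let $P_s$ be the lattice path with unit north and east steps from the south-west corner of the south-west-most box of $\mu$ (last row, first column) to the north-east corner of the last box in the first row of $\mu$, such that the boxes of $\mu$ lying north-west of $P_s$ are exactly those with $R$-entry $<s$ (and the path stays inside $\mu$ or on its boundary). For every lattice point $v$ on $P_s$, let $(r,c)$ be the box of $\lambda$ whose south-east corner is $v$, and mark the box $(r-(k-s),\,c-(k-s))$. (So the $i$-th path from the bottom is shifted $i-1$ steps diagonally to the north-west.) 6. Additionally mark all boxes of $\lambda$ that lie in no south-east chain of length $k+1$ in $\lambda$. $\Phi(F)$ is the set of all marked boxes. *)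

(* Defs.v *)
From mathcomp Require Import all_boot finmap.
From mathcomp Require Import boolp classical_sets functions.

Set Implicit Arguments.
Unset Strict Implicit.
Unset Printing Implicit Defensive.

Local Open Scope nat_scope.

(* A box (or a lattice point) is a pair (row, column).  Boxes are numbered
   from 1; the lattice point (x, y) is the south-east corner of the box (x, y),
   so that the box (i, j) has corners (i-1, j-1), ..., (i, j). *)
Notation box := (nat * nat)%type.

(* la_i is nth 0 la i.-1; trailing zero parts are harmless. *)
Definition is_ferrers (la : seq nat) : bool := sorted geq la.

Definition boxes (la : seq nat) : seq box :=
  [seq (i, j) | i <- iota 1 (size la), j <- iota 1 (nth 0 la i.-1)].

Definition ne_step : rel box := fun p q => (q.1 < p.1) && (p.2 < q.2).
Definition se_step : rel box := fun p q => (p.1 < q.1) && (p.2 < q.2).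

(* b lies in the smallest rectangle containing all boxes of c *)
Definition in_rectangle (c : seq box) (b : box) : bool :=
  [&& has (fun p => p.1 <= b.1) c, has (fun p => b.1 <= p.1) c,
      has (fun p => p.2 <= b.2) c & has (fun p => b.2 <= p.2) c].

Definition is_chain (step : rel box) (la : seq nat) (c : seq box) : Prop :=
  [/\ {subset c <= boxes la}, sorted step c &
      forall b, in_rectangle c b -> b \in boxes la].

Definition chain_free (step : rel box) (la : seq nat) (k : nat)
    (F : {fset box}) : Prop :=
  {subset F <= boxes la} /\
  ~ (exists c : seq box,
       [/\ is_chain step la c, size c = k.+1 & {subset c <= F}]).

Definition max_fillings (step : rel box) (la : seq nat) (k : nat) :
    set {fset box} :=
  fun F => chain_free step la k F /\
    (forall G : {fset box}, chain_free step la k G -> #|` G| <= #|` F|).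

Definition F_NE := max_fillings ne_step.
Definition F_SE := max_fillings se_step.

(* la without its first k rows and columns; only nonempty rows are kept *)
Definition inner (k : nat) (la : seq nat) : seq nat :=
  [seq x - k | x <- drop k la & k < x].

Definition biword (la : seq nat) (F : {fset box}) : seq (nat * nat) :=
  [seq (b.1, b.1 + b.2 - 1) |
     b <- [seq (r, c) | r <- iota 1 (size la),
                        c <- rev (iota 1 (nth 0 la r.-1))] & b \notin F].

(* A tableau is given by the list of its columns, each read downwards. *)
Definition tableau := seq (seq nat).

Definition in_tableau (T : tableau) (b : box) : bool :=
  [&& 0 < b.1, 0 < b.2 & b.1 <= size (nth [::] T b.2.-1)].

Definition entry (T : tableau) (i j : nat) : nat :=
  nth 0 (nth [::] T j.-1) i.-1.

(* Returns the new tableau and the (0-based) index of the column at the bottom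
   of which the new box appears. *)
Fixpoint eg_insert (x : nat) (T : tableau) : tableau * nat :=
  match T with
  | [::] => ([:: [:: x]], 0)
  | c :: T' =>
    match [seq z <- c | x < z] with
    | [::] => (rcons c x :: T', 0)
    | z :: zs =>
      let y := foldr minn z zs in
      if (y == x.+1) && (x \in c) then
        let: (U, j) := eg_insert x.+1 T' in (c :: U, j.+1)
      else
        let: (U, j) := eg_insert y T' in
        ([seq (if t == y then x else t) | t <- c] :: U, j.+1)
    end
  end.

Definition record (a : nat) (Q : tableau) (j : nat) : tableau :=
  set_nth [::] Q j (rcons (nth [::] Q j) a).

Definition eg_step (PQ : tableau * tableau) (ab : nat * nat) :
    tableau * tableau :=
  let: (P, j) := eg_insert ab.2 PQ.1 in (P, record ab.1 PQ.2 j).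

Definition recording_tableau (w : seq (nat * nat)) : tableau :=
  (foldl eg_step ([::], [::]) w).2.

Definition Qtab (la : seq nat) (F : {fset box}) : tableau :=
  recording_tableau (biword la F).

Definition Rtab (la : seq nat) (F : {fset box}) (i j : nat) : nat :=
  entry (Qtab la F) i j - i.

Definition has_shape (mu : seq nat) (T : tableau) : Prop :=
  forall b, in_tableau T b = (b \in boxes mu).

Definition k_flagged (k : nat) (mu : seq nat) (T : tableau) : Prop :=
  [/\ forall i j, (i, j) \in boxes mu -> 0 < entry T i j <= i + k,
      forall i j, (i, j) \in boxes mu -> (i, j.+1) \in boxes mu ->
        entry T i j <= entry T i j.+1 &
      forall i j, (i, j) \in boxes mu -> (i.+1, j) \in boxes mu ->
        entry T i j < entry T i.+1 j].

(* k_flagged only bounds entries from above by i + k; i <= entry is stated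
   separately because Rtab uses truncated subtraction. *)
Definition R_well_defined (k : nat) (mu : seq nat) (T : tableau)
    (R : nat -> nat -> nat) : Prop :=
  [/\ forall i j, (i, j) \in boxes mu -> i <= entry T i j /\ R i j <= k,
      forall i j, (i, j) \in boxes mu -> (i, j.+1) \in boxes mu ->
        R i j <= R i j.+1 &
      forall i j, (i, j) \in boxes mu -> (i.+1, j) \in boxes mu ->
        R i j <= R i.+1 j].

(* A lattice path is encoded by its word of steps, true = east and
   false = north.  A word of length size mu + head 0 mu leading from (size mu, 0)
   to (0, head 0 mu) never uses the truncation 0.-1 = 0. *)
Definition move (p : box) (e : bool) : box :=
  if e then (p.1, p.2.+1) else (p.1.-1, p.2).

Definition path_points (mu : seq nat) (w : seq bool) : seq box :=
  (size mu, 0) :: scanl move (size mu, 0) w.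

(* the lattice point p is inside mu or on its boundary *)
Definition in_closure (mu : seq nat) (p : box) : bool :=
  has (fun b => (b.1.-1 <= p.1 <= b.1) && (b.2.-1 <= p.2 <= b.2)) (boxes mu).

(* A box is north-west of a north-east path iff some point of the path is
   weakly south-east of its south-east corner. *)
Definition nw_of_path (b : box) (pts : seq box) : bool :=
  has (fun p => (b.1 <= p.1) && (b.2 <= p.2)) pts.

Definition separating_path (mu : seq nat) (R : nat -> nat -> nat) (s : nat)
    (w : seq bool) : bool :=
  let pts := path_points mu w in
  [&& last (size mu, 0) pts == (0, head 0 mu),
      all (in_closure mu) pts &
      all (fun b => nw_of_path b pts == (R b.1 b.2 < s)) (boxes mu)].

Definition sep_path_points (mu : seq nat) (R : nat -> nat -> nat) (s : nat) :
    seq box :=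
  if [pick w : (size mu + head 0 mu).-tuple bool | separating_path mu R s w]
  is Some w then path_points mu w else [::].

(* The point (x, y) of the inner shape is the south-east corner of the box
   (x + k, y + k) of la. *)
Definition path_marks (la : seq nat) (k : nat) (F : {fset box}) : seq box :=
  let mu := inner k la in
  if mu is [::] then [::] else
  [seq (v.1 + k - (k - s), v.2 + k - (k - s)) |
     s <- iota 1 k, v <- sep_path_points mu (Rtab la F) s].

Definition chainless_boxes (la : seq nat) (k : nat) : seq box :=
  [seq b <- boxes la |
     ~~ `[< exists c : seq box,
              [/\ is_chain se_step la c, size c = k.+1 & b \in c] >]].

Definition Phi (la : seq nat) (k : nat) (F : {fset box}) : {fset box} :=
  [fset b in path_marks la k F ++ chainless_boxes la k]%fset.

(* the assertions made in the course of the construction of Phi la k F *)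
Definition Phi_well_defined (la : seq nat) (k : nat) (F : {fset box}) : Prop :=
  let mu := inner k la in
  [/\ has_shape mu (Qtab la F),
      k_flagged k mu (Qtab la F),
      R_well_defined k mu (Qtab la F) (Rtab la F) &
      mu <> [::] -> forall s, 1 <= s <= k ->
        exists! w : (size mu + head 0 mu).-tuple bool,
          separating_path mu (Rtab la F) s w].

(* Main.v *)
(** Let D be the complement of F, read as the crosses of a pipe dream. A letter
    b acts on the subsets of nat by sorting the pair of membership bits at b and
    b + 1; these operators satisfy the 0-Hecke relations, and the number of
    elements at most q of the image of {1, ..., p} under the reading word of D
    is the length of the longest north-east chain of the rectangle p x q which
    avoids D. So chain-freeness of F depends only on the action of the reading
    word of D. Edelman-Greene insertion replaces a word which is shortest for
    its action by the reading word of a tableau with the same action. The same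
    chain count on the columns of this tableau shows that it contains the shape
    mu, and that it has entries k + i + j - 1 when it has exactly |mu| boxes.
    Hence the maximal fillings are those with |D| = |mu|, and their insertion
    tableaux are all the same; the recording tableau determines F by reverse
    insertion, and every k-flagged tableau is a recording tableau.

    On the other side, the complement of Phi F consists of the boxes
    (i + R(i,j), j + R(i,j)) with (i,j) in mu. A diagonal of la with k + m boxes
    holds at most k boxes of a south-east filling, so the maximal fillings have
    m zeros there, and shifting each (i,j) in mu to the zero of the same rank on
    its diagonal gives an array R; that R is weakly increasing is equivalent to
    the absence of south-east chains of length k + 1. *)

Require Import Defs.
From mathcomp Require Import all_boot finmap.
From mathcomp Require Import boolp classical_sets functions.
From mathcomp Require Import zify.

Set Implicit Arguments.
Unset Strict Implicit.
Unset Printing Implicit Defensive.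

Local Open Scope nat_scope.

(** * The 0-Hecke action of words on sets *)

(** A pair (a, b) comes from a box exactly when 1 <= a <= b, and the flag is this inequality in
    disguise. The first column of the common insertion tableau reads k + 1, k + 2, ..., which are
    the flags of the rows. Bumping paths move weakly upwards to the right, so an inserted letter is
    at least the first-column entry in the row of its new box; a flagged recording tableau therefore
    yields only pairs with a <= b. Conversely, inserting b writes only letters at least b + u into
    column u, which keeps the recorded letters below the flag. Insertion is modelled by a partial
    relation that keeps only the cases met for shortest words. In this form it can be run backwards
    from any corner, and minimality of the word excludes the missing cases in both directions. The
    bound |mu| is proved for arbitrary words that satisfy the rank conditions, not only for words of
    fillings: this makes every such word of length |mu| shortest for its action, which is what
    insertion requires. An explicit filling shows that the bound is attained. *)

Definition bubble (b : nat) (S : pred nat) : pred nat := fun x =>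
  if x == b then S b && S b.+1 else if x == b.+1 then S b || S b.+1 else S x.

(** The last letter acts first. Hence the bottom rows of a diagram and the left columns of a tableau
    act before the others. *)
Definition bubbles (v : seq nat) (S : pred nat) : pred nat := foldr bubble S v.

Definition hecke_eq (u v : seq nat) := forall S, bubbles u S = bubbles v S.

Lemma bubbles_cat u v S : bubbles (u ++ v) S = bubbles u (bubbles v S).
Proof. exact: foldr_cat. Qed.

Lemma hecke_eq_refl u : hecke_eq u u. Proof. by []. Qed.

Lemma hecke_eq_sym u v : hecke_eq u v -> hecke_eq v u.
Proof. by move=> h S; rewrite h. Qed.

Lemma hecke_eq_trans u v w : hecke_eq u v -> hecke_eq v w -> hecke_eq u w.
Proof. by move=> h h' S; rewrite h h'. Qed.

Lemma hecke_eq_cat u u' v v' : hecke_eq u u' -> hecke_eq v v' -> hecke_eq (u ++ v) (u' ++ v').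
Proof. by move=> h h' S; rewrite !bubbles_cat h h'. Qed.

Lemma hecke_eq_cons y u v : hecke_eq u v -> hecke_eq (y :: u) (y :: v).
Proof. by move=> h S /=; rewrite h. Qed.

Ltac bubble_cases :=
  repeat match goal with
  | |- context [?a == ?b :> nat] => case: (@eqP _ a b) => ?; subst; try lia
  end.

Lemma bubble_idem b S : bubble b (bubble b S) = bubble b S.
Proof.
apply: funext => x; rewrite /bubble; bubble_cases.
all: by case: (S b); case: (S b.+1).
Qed.

Lemma bubble_comm b c S : b.+1 < c -> bubble b (bubble c S) = bubble c (bubble b S).
Proof. by move=> h; apply: funext => x; rewrite /bubble; bubble_cases. Qed.

Lemma bubble_braid b S :
  bubble b (bubble b.+1 (bubble b S)) = bubble b.+1 (bubble b (bubble b.+1 S)).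
Proof.
apply: funext => x; rewrite /bubble; bubble_cases.
all: by case: (S b); case: (S b.+1); case: (S b.+2).
Qed.

Definition far (y : nat) : pred nat := fun z => (z.+1 < y) || (y.+1 < z).

Lemma bubble_far y z S : far y z -> bubble y (bubble z S) = bubble z (bubble y S).
Proof. by case/orP => h; [rewrite (bubble_comm S h) | exact: bubble_comm]. Qed.

Lemma hecke_eq_far y s : all (far y) s -> hecke_eq (y :: s) (rcons s y).
Proof.
move=> h S; elim: s h => [//|z s IH] /= /andP[hz hs].
by rewrite -IH //= bubble_far.
Qed.

(** These words play the part of reduced words. The letter 0 is excluded because a sort at 0 would
    involve the bit of 0, which the counts over 1, 2, ... do not see. *)
Definition tight (v : seq nat) :=
  0 \notin v /\
  forall v', 0 \notin v' -> hecke_eq v' v -> size v <= size v'.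

Lemma tight_catl u v : tight (u ++ v) -> tight u.
Proof.
case; rewrite mem_cat negb_or => /andP[u0 v0] h; split=> // u' u'0 e.
have := h (u' ++ v); rewrite mem_cat negb_or u'0 v0 !size_cat leq_add2r.
by apply=> //; apply: hecke_eq_cat.
Qed.

Lemma tight_catr u v : tight (u ++ v) -> tight v.
Proof.
case; rewrite mem_cat negb_or => /andP[u0 v0] h; split=> // v' v'0 e.
have := h (u ++ v'); rewrite mem_cat negb_or u0 v'0 !size_cat leq_add2l.
by apply=> //; apply: hecke_eq_cat.
Qed.

Lemma tight_hecke_eq u v :
  hecke_eq u v -> size u = size v -> 0 \notin u -> tight v -> tight u.
Proof.
move=> e es u0 [v0 h]; split=> // v' v'0 e'.
by rewrite es; apply: h => //; apply: hecke_eq_trans e.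
Qed.

(** The first x commutes past [s], meets the second x and is absorbed by idempotence, which shortens
    the word. *)
Lemma tight_repeat x s t : all (far x) s -> ~ tight (x :: s ++ x :: t).
Proof.
move=> hs [h0 /(_ (s ++ x :: t))].
have -> : 0 \notin s ++ x :: t.
  by move: h0; rewrite inE negb_or => /andP[].
rewrite /= ltnn => h; suff: false by []; apply: h => // S.
have e : hecke_eq (x :: s ++ x :: t) (s ++ x :: x :: t).
  by rewrite -cat1s catA -(cat1s x (x :: t)) catA;
     apply: hecke_eq_cat => //; rewrite cats1; apply: hecke_eq_far.
by rewrite e !bubbles_cat /= bubble_idem.
Qed.

(** * Column insertion *)

Fixpoint reading_word (T : tableau) : seq nat :=
  if T is c :: T' then reading_word T' ++ c else [::].

(* [bumps x c y c']: inserting x in the column c leaves c' and passes y on *)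
Inductive bumps (x : nat) : seq nat -> nat -> seq nat -> Prop :=
| BumpReplace a b y : all (gtn x) a -> x < y -> all (ltn y) b ->
    bumps x (a ++ y :: b) y (a ++ x :: b)
| BumpSkip a b : all (gtn x) a -> all (ltn x.+1) b ->
    bumps x (a ++ x :: x.+1 :: b) x.+1 (a ++ x :: x.+1 :: b).

Inductive inserts : nat -> tableau -> tableau -> nat -> Prop :=
| InsNil x : inserts x [::] [:: [:: x]] 0
| InsEnd x c T : all (gtn x) c -> inserts x (c :: T) (rcons c x :: T) 0
| InsBump x c y c' T U j : bumps x c y c' -> inserts y T U j ->
    inserts x (c :: T) (c' :: U) j.+1.

Lemma foldr_minn z s : all (ltn z) s -> foldr minn z s = z.
Proof.
elim: s => //= t s IH /andP[h1 h2]; rewrite IH //; lia.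
Qed.

Lemma filter_none (T : eqType) (P : pred T) s :
  {in s, forall z, ~~ P z} -> filter P s = [::].
Proof.
move=> h; apply/eqP; rewrite -(negbK (_ == _)) -has_filter -all_predC.
by apply/allP => z /h.
Qed.

Lemma filter_id_in (T : eqType) (P : pred T) s : {in s, forall z, P z} -> filter P s = s.
Proof. by move=> h; apply/all_filterP/allP => z /h. Qed.

Lemma eg_insert_spec x T U j : inserts x T U j -> eg_insert x T = (U, j).
Proof.
elim=> {x T U j} [x //|x c T h|x c y c' T U j hb _ IH] /=.
  rewrite filter_none // => z /(allP h) /= ?; lia.
case: hb IH => [a b {}y ha hxy hb|a b ha hb] IH.
  have hf : [seq z <- a ++ y :: b | x < z] = y :: b.
    rewrite filter_cat filter_none /= ?hxy ?filter_id_in // => z.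
    - move/(allP hb) => /=; lia.
    - move/(allP ha) => /=; lia.
  rewrite hf foldr_minn //.
  have xc : x \notin a ++ y :: b.
    rewrite mem_cat inE !negb_or; apply/and3P; split; last 2 first.
    - lia.
    - apply/negP => /(allP hb) /=; lia.
    - apply/negP => /(allP ha) /=; lia.
  rewrite (negbTE xc) andbF IH; congr ((_ :: _), _).
  rewrite map_cat /= eqxx; congr (_ ++ _ :: _).
    rewrite -[RHS]map_id; apply/eq_in_map => z /(allP ha) /= ?.
    by case: eqP => //; lia.
  rewrite -[RHS]map_id; apply/eq_in_map => z /(allP hb) /= ?.
  by case: eqP => //; lia.
have hf : [seq z <- a ++ x :: x.+1 :: b | x < z] = x.+1 :: b.
  rewrite filter_cat filter_none /= ?ltnn ?ltnSn ?filter_id_in // => z.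
  - move/(allP hb) => /=; lia.
  - move/(allP ha) => /=; lia.
by rewrite hf foldr_minn // eqxx mem_cat inE eqxx orbT IH.
Qed.

(** * Insertion into strictly increasing tableaux *)

Definition colle (c d : seq nat) :=
  size d <= size c /\ forall i, i < size d -> nth 0 c i < nth 0 d i.

(** An increasing tableau: rows as well as columns increase strictly. Empty columns are excluded so
    that the list has no padding. *)
Fixpoint valid (T : tableau) : Prop :=
  if T is c :: T' then
    [/\ c <> [::], sorted ltn c, colle c (head [::] T') & valid T']
  else True.

Lemma sorted_ltn_cat x a b : all (gtn x) a -> all (ltn x) b ->
  sorted ltn (a ++ x :: b) = sorted ltn a && sorted ltn b.
Proof.
move=> ha hb; rewrite !(sorted_pairwise ltn_trans) pairwise_cat /= hb /=.
rewrite allrel_consr; suff -> : allrel ltn a b by have -> : all (ltn^~ x) a by [].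
apply/allrelP => y z /(allP ha) /= h /(allP hb) /= h'; exact: ltn_trans h h'.
Qed.

Lemma sub_gtn x y s : x < y -> all (gtn x) s -> all (gtn y) s.
Proof. by move=> h; apply: sub_all => z /= ?; lia. Qed.

Lemma sub_ltn x y s : x < y -> all (ltn y) s -> all (ltn x) s.
Proof. by move=> h; apply: sub_all => z /= ?; lia. Qed.

Lemma bump_sorted x c y c' : bumps x c y c' -> sorted ltn c = sorted ltn c'.
Proof.
case=> [a b {}y ha hxy hb|//].
by rewrite !sorted_ltn_cat //; [exact: sub_ltn hb|exact: sub_gtn ha].
Qed.

Lemma bump_lt x c y c' : bumps x c y c' -> x < y.
Proof. by case. Qed.

Lemma bump_size x c y c' : bumps x c y c' -> size c = size c'.
Proof. by case=> [a b {}y _ _ _|//]; rewrite !size_cat. Qed.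

Lemma sorted_split x c : sorted ltn c -> exists a b,
  [/\ c = a ++ b, all (gtn x) a & all (leq x) b].
Proof.
elim: c => [|z c IH]; first by exists [::], [::].
move=> hs; case: (ltnP z x) => h; last first.
  exists [::], (z :: c); split=> //=; rewrite h /=.
  move: hs; rewrite (sorted_pairwise ltn_trans) /= => /andP[hz _].
  by apply: sub_all hz => t /=; lia.
have [//|a [b [-> ha hb]]] := IH; first exact: path_sorted hs.
by exists (z :: a), b; rewrite /= h.
Qed.

Lemma sorted_lt_head z c : sorted ltn (z :: c) -> all (ltn z) c.
Proof. by rewrite (sorted_pairwise ltn_trans) /= => /andP[]. Qed.

(** The cases that [bumps] leaves out are those where x lies in the column and x + 1 does not. The
    new x could then be moved next to the old one, against [tight_repeat]. *)
Lemma insert_column x c : sorted ltn c -> tight (rcons c x) ->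
  all (gtn x) c \/ exists y c', bumps x c y c'.
Proof.
move=> hs ht; have [a [b [e ha hb]]] := sorted_split x hs; subst c.
case: b hs ht hb => [|y b] hs ht hb; first by left; rewrite cats0.
have hyb : all (ltn y) b.
  by apply: sorted_lt_head; apply: (subseq_sorted ltn_trans _ hs); apply: suffix_subseq.
move: hb => /= /andP[]; rewrite leq_eqVlt => /orP[/eqP e|h] hb; last first.
  by right; exists y, (a ++ x :: b); constructor.
subst y; case: b hs ht hyb hb => [|y b] hs ht hyb hb.
  exfalso; move: ht; rewrite -cats1 -catA => /tight_catr /=.
  by apply: (@tight_repeat _ [::] [::]).
move: (hyb) => /= /andP[hxy _].
have hb' : all (ltn y) b.
  apply: sorted_lt_head; apply: (subseq_sorted ltn_trans _ hs).
  by apply/(subseq_trans (subseq_cons _ x))/suffix_subseq.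
case: (ltngtP y x.+1) => h; [lia| |].
  exfalso; move: ht; rewrite -cats1 -catA => /tight_catr.
  rewrite cat_cons; apply: (@tight_repeat _ _ [::]).
  apply/allP => z; rewrite inE => /orP[/eqP ->|/(allP hb')] /=; rewrite /far; lia.
by subst y; right; exists x.+1, (a ++ x :: x.+1 :: b); constructor.
Qed.

(** A replacement needs only commutations of far letters: x moves left past the larger entries, then
    y moves left past the smaller ones. A skip needs in addition one braid relation, which turns x,
    x + 1, x into x + 1, x, x + 1. *)
Lemma bump_hecke_eq x c y c' : bumps x c y c' -> hecke_eq (rcons c x) (y :: c').
Proof.
case=> [a b {}y ha hxy hb|a b ha hb].
  rewrite -cats1 -catA /=.
  have e1 : hecke_eq (a ++ y :: b ++ [:: x]) (a ++ y :: x :: b).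
    apply: hecke_eq_cat => //; apply: hecke_eq_cons.
    apply: hecke_eq_sym; rewrite cats1; apply: hecke_eq_far.
    apply/allP => z /(allP hb) /=; rewrite /far; lia.
  apply: (hecke_eq_trans e1); rewrite -cat_rcons.
  apply: (@hecke_eq_cat (rcons a y) (y :: a)) => //; apply/hecke_eq_sym/hecke_eq_far.
  apply/allP => z /(allP ha) /=; rewrite /far; lia.
rewrite -cats1 -catA /=.
have e1 : hecke_eq (a ++ x :: x.+1 :: b ++ [:: x]) (a ++ [:: x; x.+1; x] ++ b).
  apply: hecke_eq_cat => //; apply: hecke_eq_cons; apply: hecke_eq_cons.
  apply: hecke_eq_sym; rewrite cats1; apply: hecke_eq_far.
  apply/allP => z /(allP hb) /=; rewrite /far; lia.
apply: (hecke_eq_trans e1).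
have e2 : hecke_eq (a ++ [:: x; x.+1; x] ++ b) (a ++ [:: x.+1; x; x.+1] ++ b).
  by apply: hecke_eq_cat => //; apply: hecke_eq_cat => // S /=; rewrite bubble_braid.
apply: (hecke_eq_trans e2).
have e3 : hecke_eq (rcons a x.+1) (x.+1 :: a).
  apply/hecke_eq_sym/hecke_eq_far/allP => z /(allP ha) /=; rewrite /far; lia.
by have := hecke_eq_cat e3 (hecke_eq_refl ([:: x; x.+1] ++ b)); rewrite cat_rcons.
Qed.

Lemma inserts_hecke_eq x T U j : inserts x T U j -> hecke_eq (rcons (reading_word T) x) (reading_word U).
Proof.
elim=> {x T U j} [x //|x c T h|x c y c' T U j hb _ IH] /=.
  by rewrite rcons_cat.
rewrite rcons_cat; apply: (@hecke_eq_trans _ (reading_word T ++ y :: c')).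
  by apply: hecke_eq_cat => //; apply: bump_hecke_eq.
by rewrite -cat_rcons; apply: hecke_eq_cat.
Qed.

Lemma inserts_size x T U j : inserts x T U j -> size (reading_word U) = (size (reading_word T)).+1.
Proof.
elim=> {x T U j} [x //|x c T h|x c y c' T U j hb _ IH] /=.
  by rewrite !size_cat size_rcons addnS.
by rewrite !size_cat IH (bump_size hb).
Qed.

Lemma bump_pos x c y c' : bumps x c y c' -> 
  (0 \notin rcons c x) = (0 \notin y :: c').
Proof.
case=> [a b {}y ha hxy hb|a b ha hb].
  by rewrite mem_rcons !(inE, mem_cat) !negb_or; do !bool_congr.
by rewrite mem_rcons !(inE, mem_cat) !negb_or; case: (0 == x); rewrite //= ?andbF.
Qed.

Lemma inserts_pos x T U j : inserts x T U j ->
  (0 \notin rcons (reading_word T) x) = (0 \notin reading_word U).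
Proof.
elim=> {x T U j} [x //|x c T h|x c y c' T U j hb _ IH] /=.
  by rewrite rcons_cat.
rewrite rcons_cat mem_cat negb_or (bump_pos hb) mem_cat negb_or -IH.
rewrite mem_rcons !inE !negb_or; by do !bool_congr.
Qed.

Lemma inserts_tight x T U j : inserts x T U j ->
  tight (rcons (reading_word T) x) <-> tight (reading_word U).
Proof.
move=> h; have e := inserts_hecke_eq h; have s := inserts_size h.
have p := inserts_pos h; split=> ht.
  apply: (tight_hecke_eq (hecke_eq_sym e) _ _ ht); first by rewrite s size_rcons.
  by rewrite -p; case: ht.
apply: (tight_hecke_eq e _ _ ht); first by rewrite s size_rcons.
by rewrite p; case: ht.
Qed.

Lemma inserts_exists x T : valid T -> tight (rcons (reading_word T) x) ->
  exists U j, inserts x T U j.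
Proof.
elim: T x => [|c T IH] x /=; first by exists [:: [:: x]], 0; constructor.
case=> _ hs _ hT; rewrite rcons_cat => ht.
case: (insert_column hs (tight_catr ht)) => [h|[y [c' hb]]].
  by exists (rcons c x :: T), 0; constructor.
have [] := IH y hT.
  apply: (@tight_catl _ c'); rewrite cat_rcons; apply: (tight_hecke_eq _ _ _ ht).
  - by apply: hecke_eq_cat => //; apply/hecke_eq_sym/bump_hecke_eq.
  - by rewrite !size_cat /= size_rcons (bump_size hb).
  - by rewrite mem_cat negb_or -(bump_pos hb) -negb_or -mem_cat; case: ht.
by move=> U [j hU]; exists (c' :: U), j.+1; apply: InsBump hb hU.
Qed.

Lemma nth_lt_all (P : pred nat) s i : all P s -> i < size s -> P (nth 0 s i).
Proof. by move=> h hi; apply: (allP h); apply: mem_nth. Qed.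

Lemma sorted_nth_lt s i j : sorted ltn s -> i < j -> j < size s ->
  nth 0 s i < nth 0 s j.
Proof.
move=> hs hij hj.
by apply: (sorted_ltn_nth ltn_trans 0 hs) => //; rewrite inE //; apply: ltn_trans hj.
Qed.

(** Restates [bumps] by positions, since [colle] compares columns entry by entry. The last
    alternative separates replacing from skipping. *)
Lemma bump_index x c y c' : bumps x c y c' -> exists i,
  [/\ i < size c', nth 0 c' i = x, forall u, u < i -> nth 0 c' u < x,
      forall u, i < u < size c' -> y <= nth 0 c' u &
      [/\ nth 0 c i = y, forall u, u <> i -> nth 0 c u = nth 0 c' u &
          forall u, i < u < size c' -> y < nth 0 c' u]
      \/ c = c' /\ y = x.+1].
Proof.
case=> [a b {}y ha hxy hb|a b ha hb]; exists (size a); split.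
- rewrite size_cat /=; lia.
- by rewrite nth_cat ltnn subnn.
- by move=> u hu; rewrite nth_cat hu; apply: (nth_lt_all ha).
- move=> u /andP[hu]; rewrite size_cat /= nth_cat [u < size a]ltnNge (ltnW hu) /= => h.
  case e : (u - size a) => [|n]; first lia.
  by apply/ltnW/(nth_lt_all hb); lia.
- left; split.
  + by rewrite nth_cat ltnn subnn.
  + move=> u hu; rewrite !nth_cat; case: ltnP => // h.
    by case e : (u - size a) => [|n] //; lia.
  + move=> u /andP[hu]; rewrite size_cat /= nth_cat [u < size a]ltnNge (ltnW hu) /= => h.
    case e : (u - size a) => [|n]; first lia.
    by apply: (nth_lt_all hb); lia.
- rewrite size_cat /=; lia.
- by rewrite nth_cat ltnn subnn.
- by move=> u hu; rewrite nth_cat hu; apply: (nth_lt_all ha).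
- move=> u /andP[hu]; rewrite size_cat /= nth_cat [u < size a]ltnNge (ltnW hu) /= => h.
  case e : (u - size a) => [|[|n]] //=; first lia.
  by apply/ltnW/(nth_lt_all hb); lia.
- by right.
Qed.

(** The effect of the next step of an insertion on the next column alone, where a column that does
    not exist yet counts as empty. *)
Definition receives (y : nat) (d d' : seq nat) :=
  (all (gtn y) d /\ d' = rcons d y) \/ exists z, bumps y d z d'.

Lemma inserts_head y T U j : inserts y T U j ->
  receives y (head [::] T) (head [::] U).
Proof.
case=> {y T U j} [x|x c T h|x c y c' T U j hb _] /=; first by left.
  by left.
by right; exists y.
Qed.

Lemma receives_index y d d' : receives y d d' -> exists t,
  [/\ t < size d' /\ size d <= size d', t <= size d /\ nth 0 d' t = y,
      forall u, u < t -> nth 0 d u < y,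
      forall u, u <> t -> u < size d -> nth 0 d u = nth 0 d' u &
      [\/ size d = t /\ size d' = t.+1, size d = size d' /\ y < nth 0 d t |
          [/\ d = d', t.+1 < size d & nth 0 d t.+1 = y.+1]]].
Proof.
case=> [[ha ->]|[z hb]].
  exists (size d); rewrite size_rcons; split.
  - by rewrite ltnSn leqnSn.
  - by rewrite leqnn nth_rcons ltnn eqxx.
  - by move=> u hu; apply: (nth_lt_all ha).
  - by move=> u _ hu; rewrite nth_rcons hu.
  - by constructor 1.
case: hb => [a b {}z ha hyz hb|a b ha hb]; exists (size a).
  split; rewrite ?size_cat /= ?nth_cat ?ltnn ?subnn /=.
  - by split; lia.
  - by split=> //; lia.
  - by move=> u hu; rewrite nth_cat hu; apply: (nth_lt_all ha).
  - move=> u hu _; rewrite !nth_cat; case: ltnP => // h.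
    by case e : (u - size a) => [|n] //; lia.
  - by constructor 2.
split; rewrite ?size_cat /= ?nth_cat ?ltnn ?subnn /=.
- by split; lia.
- by split=> //; lia.
- by move=> u hu; rewrite nth_cat hu; apply: (nth_lt_all ha).
- by [].
- constructor 3; split=> //; first lia.
  by rewrite ltnNge leqnSn /= subSn // subnn.
Qed.

(** The bumping path does not descend: y enters the next column in a row t weakly above the row i of
    x, because the entry of the next column in row i is larger than its left neighbour and so at
    least y. *)
Lemma colle_fwd x c y c' d d' : bumps x c y c' -> receives y d d' ->
  colle c d -> colle c' d'.
Proof.
move=> hb hd [hsz hcd]; have hs := bump_size hb.
have [i [i1 i2 i3 i4 i5]] := bump_index hb.
have [t [[t1 t1'] [t2 t3] t4 t5 t6]] := receives_index hd.
have hxy := bump_lt hb.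
have ti : t <= i.
  case: leqP => // h; have hi : i < size d by lia.
  have := hcd i hi; have := t4 i h.
  by case: i5 => [[-> _ _]|[-> ->]]; [lia|rewrite i2; lia].
have le u : nth 0 c' u <= nth 0 c u.
  case: i5 => [[e1 e2 _]|[-> _] //].
  by have [->|/eqP n] := eqVneq u i; [rewrite e1 i2; lia|rewrite e2].
split; first by case: t6 => [[]|[]|[e ? ?]]; try subst d'; lia.
move=> u hu; have [->|/eqP n] := eqVneq u t.
  rewrite t3; have [->|n'] := eqVneq t i; first by rewrite i2.
  by apply: (ltn_trans (i3 _ _)) => //; lia.
have hu' : u < size d by case: t6 => [[]|[]|[e ? ?]]; try subst d'; lia.
by rewrite -t5 //; apply: leq_ltn_trans (le u) (hcd u hu').
Qed.

(** Undoing a replacement puts the larger letter y back into row i of the left column. The right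
    column still exceeds it there, because y entered that column weakly above row i. *)
Lemma colle_bwd x c y c' d d' : bumps x c y c' -> receives y d d' ->
  sorted ltn d' -> colle c' d' -> colle c d.
Proof.
move=> hb hd sd [hsz hcd]; have hs := bump_size hb.
have [i [i1 i2 i3 i4 i5]] := bump_index hb.
have [t [[t1 t1'] [t2 t3] t4 t5 t6]] := receives_index hd.
have hxy := bump_lt hb.
have ti : t <= i.
  case: leqP => // h; have := hcd t t1; rewrite t3.
  by have := i4 t; rewrite h /= => /(_ _); lia.
have le u : u < size d -> nth 0 d' u <= nth 0 d u.
  move=> hu; have [e|/eqP n] := eqVneq u t; last by rewrite t5.
  by subst u; case: t6 => [[]|[]|[e ? ?]]; try subst d'; lia.
split; first lia.
move=> u hu; have h' := hcd u (leq_trans hu t1'); have h'' := le u hu.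
case: i5 => [[e1 e2 e3]|[-> _]]; last by lia.
have [e|/eqP n] := eqVneq u i; last by rewrite e2 //; lia.
subst u; rewrite e1.
have [e|n] := eqVneq i t; last first.
  by apply: leq_trans h''; rewrite -{1}t3; apply: sorted_nth_lt => //; lia.
(* With t = i, a skip in the right column would put y + 1 just below row i there, leaving no value
   for the left entry of that row, which exceeds y. *)
subst t; case: t6 => [[h _]|[_ ->] //|[e h1 h2]]; first lia.
have := hcd i.+1; rewrite -e h2 h1 => /(_ isT).
by have := e3 i.+1; rewrite ltnSn /= => /(_ _); lia.
Qed.

Lemma valid_head T : valid T -> sorted ltn (head [::] T).
Proof. by case: T => //= c T []. Qed.

Lemma inserts_valid x T U j : inserts x T U j -> valid T -> valid U.
Proof.
elim=> {x T U j} [x _ //|x c T h|x c y c' T U j hb hi IH] /=.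
  case=> h1 h2 [h3 h4] h5; split=> //.
  - by case: (c).
  - by rewrite -cats1 sorted_ltn_cat //= h2.
  - split; first by rewrite size_rcons ltnW.
    move=> i hi; rewrite nth_rcons (leq_trans hi h3); exact: h4.
case=> h1 h2 h3 h4; split=> //; last exact: IH.
- by move: (bump_size hb); case: (c) h1 => //; case: (c').
- by rewrite -(bump_sorted hb).
- by apply: colle_fwd hb (inserts_head hi) h3.
Qed.

Lemma inserts_corner x T U j : inserts x T U j -> valid T -> 
  size (nth [::] U j.+1) < size (nth [::] U j).
Proof.
elim=> {x T U j} [x _ //|x c T h|x c y c' T U j hb hi IH] /=.
  by case=> _ _ [h1 _] _; rewrite nth0 size_rcons.
by case=> _ _ _ /IH.
Qed.

(** * Reverse insertion *)

Lemma inserts_valid_bwd x T U j : inserts x T U j -> valid U ->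
  size (nth [::] U j.+1) < size (nth [::] U j) -> {in T, forall c, c <> [::]} ->
  valid T.
Proof.
elim=> {x T U j} [x _ //|x c T h|x c y c' T U j hb hi IH].
  rewrite /= nth0 size_rcons; case=> h1 h2 [h3 h4] h5 hsz hne; split=> //.
  - by apply: hne; rewrite inE eqxx.
  - by move: h2; rewrite -cats1 sorted_ltn_cat //= andbT.
  - split=> // i hi; have := h4 i hi; rewrite nth_rcons.
    by rewrite (_ : i < size c) //; apply: leq_trans hi _.
move=> /= [h1 h2 h3 h4] hsz hne; split.
- by apply: hne; rewrite inE eqxx.
- by rewrite (bump_sorted hb).
- by apply: colle_bwd hb (inserts_head hi) (valid_head h4) h3.
- by apply: IH => // d hd; apply: hne; rewrite inE hd orbT.
Qed.

(** Membership of y in [c'] tells the two cases apart: a replacement has removed y, and x is then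
    the largest entry below y. *)
Lemma bump_pre x c y c' : bumps x c y c' ->
  if y \in c' then x.+1 = y /\ c = c'
  else exists2 a, [seq z <- c' | z < y] = rcons a x &
                  c = a ++ y :: [seq z <- c' | y < z].
Proof.
case=> [a b {}y ha hxy hb|a b ha hb]; last by rewrite mem_cat !inE eqxx !orbT.
rewrite (_ : y \in _ = false); last first.
  apply/negbTE; rewrite mem_cat inE !negb_or; apply/and3P; split; last 2 first.
  - lia.
  - apply/negP => /(allP hb) /=; lia.
  - apply/negP => /(allP ha) /=; lia.
have [yx ay yb] : [/\ y < x = false, {in a, forall z, z < y} &
    {in b, forall z, y < z}].
  split; first by lia.
    by move=> z /(allP ha) /=; lia.
  by move=> z /(allP hb).
exists a; rewrite filter_cat /= ?hxy ?yx.
  rewrite filter_id_in ?(@filter_none _ _ b) ?cats1 //.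
  by move=> z /yb; lia.
rewrite (@filter_none _ _ a) ?filter_id_in //.
by move=> z /ay; lia.
Qed.

Lemma bump_inj x1 x2 c1 c2 y c' : bumps x1 c1 y c' -> bumps x2 c2 y c' ->
  x1 = x2 /\ c1 = c2.
Proof.
move=> /bump_pre h1 /bump_pre h2; case: ifP h1 h2 => _.
  by case=> e1 -> [e2 ->]; split=> //; lia.
by case=> a1 e1 -> [a2 e2 ->]; move: e2; rewrite e1 => /rcons_inj[-> ->].
Qed.

Lemma inserts_inj x1 x2 T1 T2 U j : inserts x1 T1 U j -> inserts x2 T2 U j ->
  {in T1, forall c, c <> [::]} -> {in T2, forall c, c <> [::]} ->
  x1 = x2 /\ T1 = T2.
Proof.
have ne c (T : tableau) : {in c :: T, forall d, d <> [::]} ->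
    c <> [::] /\ {in T, forall d, d <> [::]}.
  by move=> h; split=> [|d hd]; apply: h; rewrite inE ?eqxx ?hd ?orbT.
have one (c : seq nat) x y : rcons c x = [:: y] -> c = [::] by case: c => // ? [].
move=> h; elim: h x2 T2 => {x1 T1 U j} [x|x c T h|x c y c' T U j hb hi IH] x2 T2 h2.
- move e : [:: [:: x]] h2 => U h2; move ej : 0 h2 => j h2.
  case: x2 T2 U j / h2 e ej => [x' [->] //|x' c T h|//].
  by case=> /esym/one ec _ _ _ /ne[].
- move e : (rcons c x :: T) h2 => U h2; move ej : 0 h2 => j h2.
  case: x2 T2 U j / h2 e ej => [x' [/one ec _] _ /ne[] //|x' c' T' h'|//].
  by case=> /rcons_inj[-> ->] ->.
move e : (c' :: U) h2 => U' h2; move ej : j.+1 h2 => j' h2.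
case: x2 T2 U' j' / h2 e ej => [//|//|x2 c2 y2 c2' T2 U2 j2 hb2 hi2].
case=> e1 e2 [e3] /ne[_ n1] /ne[_ n2]; subst c2' U2 j2.
have [e1 e2] := IH _ _ hi2 n1 n2; subst.
by have [-> ->] := bump_inj hb hb2.
Qed.

Lemma bump_mem x c y c' : bumps x c y c' -> x \in c'.
Proof. by case=> [a b *|a b *]; rewrite mem_cat inE eqxx orbT. Qed.

Lemma inserts_head_mem x T U j : inserts x T U j -> x \in head [::] U.
Proof.
case=> {x T U j} [x|x c T _|x c y c' T U j hb _] /=.
- by rewrite inE.
- by rewrite mem_rcons inE eqxx.
- exact: bump_mem hb.
Qed.

Lemma valid_nonempty T : valid T -> {in T, forall c, c <> [::]}.
Proof.
elim: T => // c T IH /= [h _ _ hT] d; rewrite inE => /orP[/eqP -> //|].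
exact: IH.
Qed.

(** In each column the letter to give back is the largest entry below y; it exists because y stands
    in the next column and rows increase strictly. If y also lies in this column, it must be
    preceded by y - 1, since otherwise y followed by the column contradicts [tight_repeat]. *)
Lemma inserts_bwd U j : valid U -> tight (reading_word U) -> 
  size (nth [::] U j.+1) < size (nth [::] U j) ->
  exists x T, inserts x T U j /\ {in T, forall c, c <> [::]}.
Proof.
elim: U j => [|c U IH] [|j] //=.
  case=> h1 h2 [h3 h4] h5 _; rewrite nth0 => hsz.
  case/lastP: c h1 h2 h3 h4 hsz => // c x _ h2 h3 h4; rewrite size_rcons => hsz.
  have hx : all (gtn x) c.
    move: h2; rewrite (sorted_pairwise ltn_trans) pairwise_rcons => /andP[h _].
    by apply: sub_all h => z.
  case: c h2 h3 h4 hsz hx => [|z c] h2 h3 h4 hsz hx.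
    case: U IH h3 h4 h5 hsz => [|d U] IH h3 h4 h5 hsz.
      by exists x, [::]; split=> //; constructor.
    by case: h5 => h _ _ _; case: (d) h hsz.
  exists x, ((z :: c) :: U); split; first by constructor.
  by move=> d; rewrite inE => /orP[/eqP -> //|]; apply: valid_nonempty.
case=> h1 h2 h3 h5 ht hsz.
have [//|y [T [hi hT]]] := IH j h5 (tight_catl ht) _.
suff [x [c0 hb]] : exists x c0, bumps x c0 y c.
  exists x, (c0 :: T); split; first exact: InsBump hb hi.
  move=> d; rewrite inE => /orP[/eqP -> |]; last exact: hT.
  by move: (bump_size hb); case: (c0) => // /esym/size0nil.
have [a [b [e ha hb]]] := sorted_split y h2.
have hne : a <> [::].
  have hy := inserts_head_mem hi.
  case: h3 => sz /(_ (index y (head [::] U))).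
  rewrite index_mem nth_index // => /(_ hy) hlt hn; subst a c.
  have hi' : index y (head [::] U) < size b.
    by apply: leq_trans sz; rewrite index_mem.
  have /= := allP hb _ (mem_nth 0 hi'); rewrite cat0s in hlt; lia.
case/lastP: a e ha hne => // a x e ha _; subst c.
move: ha; rewrite all_rcons => /andP[/= hxy ha].
have hax : all (gtn x) a.
  move: h2; rewrite (sorted_pairwise ltn_trans) pairwise_cat pairwise_rcons.
  by case/and3P=> _ /andP[h _] _; apply: sub_all h => z.
clear h1; case: b hb h2 h3 ht => [|z b] hb h2 h3 ht.
  by exists x, (a ++ [:: y]); rewrite cats0 -cats1; constructor.
have hzb : all (ltn z) b.
  by apply: sorted_lt_head; apply: (subseq_sorted ltn_trans _ h2); apply: suffix_subseq.
move: hb => /= /andP[]; rewrite leq_eqVlt => /orP[/eqP e|h] hb; last first.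
  exists x, (a ++ y :: z :: b); rewrite cat_rcons; constructor=> //.
  by rewrite /= h; apply: sub_ltn hzb.
subst z; have [e|hne] := eqVneq y x.+1.
  subst y; exists x, (a ++ x :: x.+1 :: b); rewrite cat_rcons; constructor=> //.
exfalso; have htt : tight (y :: rcons a x ++ y :: b).
  apply: (@tight_catr (reading_word T)); rewrite -cat_rcons; apply: (tight_hecke_eq _ _ _ ht).
  - by apply: hecke_eq_cat => //; apply: (inserts_hecke_eq hi).
  - by rewrite !size_cat (inserts_size hi) size_rcons.
  - rewrite mem_cat negb_or (inserts_pos hi).
    by rewrite -negb_or -mem_cat; case: ht.
apply: tight_repeat htt; rewrite all_rcons /far.
apply/andP; split; first by lia.
by apply/allP => u /(allP hax) /=; lia.
Qed.

(** * Comparison and bounds of bumping paths *)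

Lemma bump_out_lt x c y c' x' y' c'' : bumps x c y c' -> bumps x' c' y' c'' ->
  (x' < x -> y' < y) /\ (x < x' -> y < y').
Proof.
move=> hb hb'; have hx := bump_mem hb; have hxy := bump_lt hb.
have hx' := bump_lt hb'.
have mem' : y' \in c' by case: hb' => [a b *|a b *]; rewrite mem_cat !inE eqxx !orbT.
have min' z : z \in c' -> x' < z -> y' <= z.
  case: {hx hx' mem'} hb' => [a b {}y' ha h hb0|a b ha hb0]; rewrite mem_cat !inE.
    case/or3P=> [/(allP ha) /=|/eqP -> //|/(allP hb0) /=]; lia.
  by case/or4P=> [/(allP ha) /=|/eqP ->|/eqP ->|/(allP hb0) /=]; lia.
split=> h; first by apply: leq_ltn_trans (min' _ hx h) hxy.
case: {min' hb' hx hxy} hb mem' => [a b {}y ha hxy hb|a b ha hb]; rewrite mem_cat !inE.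
  case/or3P=> [/(allP ha) /=|/eqP e|/(allP hb) //]; lia.
by case/or4P=> [/(allP ha) /=|/eqP e|/eqP e|/(allP hb) //]; lia.
Qed.

(** By [bump_out_lt] the order of two successive letters is inherited by the letters they pass on,
    so the two bumping paths do not cross. Since the letters of one row of a diagram are read
    decreasingly, equal recorded letters go to columns further and further right. *)
Lemma inserts_pieri x T U j x' V j' : inserts x T U j -> inserts x' U V j' ->
  (x' < x -> j < j') /\ (x < x' -> j' <= j).
Proof.
move=> h; elim: h x' V j' => {x T U j} [x|x c T h|x c y c' T U j hb hi IH] x' V j'.
- move e : [:: _] => U h'; case: h' e => [//|x1 c1 T1 h1 [ec eT]|x1 c1 y1 c1' T1 U1 j1 hb1 _ [ec eT]].
    by subst c1; move: h1 => /= /andP[/=]; lia.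
  split=> // hx; exfalso.
  case: hb1 ec hx => [[|? []] // b {}y1 _ h _|[|? []] //]; case=> *; lia.
- move e : (_ :: _) => U h'; case: h' e => [//|x1 c1 T1 h1 [ec eT]|x1 c1 y1 c1' T1 U1 j1 hb1 _ [ec eT]].
    by subst c1; move: h1; rewrite all_rcons => /= /andP[]; lia.
  split=> // hx; subst c1; exfalso.
  have hy : y1 \in rcons c x.
    by case: {hx} hb1 => [a b *|a b *]; rewrite mem_cat !inE eqxx !orbT.
  have := bump_lt hb1; move: hy; rewrite mem_rcons inE => /orP[/eqP ->|/(allP h) /=]; lia.
move e : (_ :: _) => W h'; case: h' e => [//|x1 c1 T1 h1 [ec eT]|x1 c1 y1 c1' T1 U1 j1 hb1 hi1 [ec eT]].
  subst c1; split=> // hx; have := allP h1 _ (bump_mem hb) => /=; lia.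
subst c1 T1; have [h1 h2] := bump_out_lt hb hb1; have [h3 h4] := IH _ _ _ hi1.
by split=> hx; [rewrite ltnS; apply/h3/h1|rewrite ltnS; apply/h4/h2].
Qed.

Lemma inserts_shape x T U j u : inserts x T U j ->
  size (nth [::] U u) = size (nth [::] T u) + (u == j).
Proof.
move=> h; elim: h u => {x T U j} [x|x c T h|x c y c' T U j hb hi IH] [|u] //=.
- by rewrite !nth_nil.
- by rewrite size_rcons addn1.
- by rewrite addn0.
- by rewrite addn0 (bump_size hb).
Qed.

(** Every bump raises the letter by at least one, so the letter reaching column u is at least x + u.
    Entries above its place are untouched, those below it are larger still. *)
Lemma inserts_entry_ge x T U j u i : inserts x T U j ->
  i < size (nth [::] U u) ->
  (i < size (nth [::] T u) /\ nth 0 (nth [::] U u) i = nth 0 (nth [::] T u) i)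
  \/ x + u <= nth 0 (nth [::] U u) i.
Proof.
move=> h; elim: h u => {x T U j} [x|x c T h|x c y c' T U j hb hi IH] [|u] /=.
- by rewrite ltnS leqn0 => /eqP -> /=; right; rewrite addn0.
- by rewrite nth_nil.
- rewrite size_rcons ltnS nth_rcons addn0.
  by case: ltngtP => // hi _; [left|right].
- by left.
- rewrite addn0 => hi'; have [k [k1 k2 k3 k4 k5]] := bump_index hb.
  have hxy := bump_lt hb.
  case: (ltngtP i k) => h; last by right; subst i; rewrite k2.
    left; rewrite (bump_size hb); split=> //.
    by case: k5 => [[_ e _]|[-> _] //]; rewrite e //; lia.
  by right; have := k4 i; rewrite h hi' => /(_ isT); lia.
- move/IH => [[h1 h2]|h]; [by left|right].
  by have := bump_lt hb; lia.
Qed.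

Lemma inserts_entry_le x T U j u i : inserts x T U j ->
  i < size (nth [::] T u) -> nth 0 (nth [::] U u) i <= nth 0 (nth [::] T u) i.
Proof.
move=> h; elim: h u => {x T U j} [x|x c T h|x c y c' T U j hb hi IH] [|u] //=.
- by move=> h'; rewrite nth_rcons h'.
- move=> hi'; have [k [k1 k2 k3 k4 k5]] := bump_index hb.
  case: k5 => [[e1 e2 e3]|[-> _] //].
  have [e|/eqP n] := eqVneq i k; last by rewrite e2.
  by subst i; rewrite k2 e1 ltnW // (bump_lt hb).
exact: IH.
Qed.

(** As the bumping path moves weakly upwards to the right, x stands in the first column in the row
    of the new box or further down. *)
Lemma inserts_row_le x T U j : inserts x T U j -> valid U ->
  nth 0 (head [::] U) (size (nth [::] T j)) <= x.
Proof.
move=> h hU; suff [i [hi hl e]] : exists i, [/\ i < size (head [::] U),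
    size (nth [::] T j) <= i & nth 0 (head [::] U) i = x].
  move: hl; rewrite leq_eqVlt => /orP[/eqP ->|hl]; first by rewrite e.
  by rewrite -e ltnW // sorted_nth_lt // valid_head.
elim: h hU => {x T U j} [x|x c T h|x c y c' T U j hb hi IH] /=.
- by exists 0.
- by exists (size c); rewrite size_rcons nth_rcons ltnn eqxx.
case=> h1 h2 [h3 h3'] /IH[i [i1 i2 i3]].
have [k [k1 k2 k3 k4 k5]] := bump_index hb.
exists k; split=> //; apply: leq_trans i2 _.
case: leqP => // hk; have := h3' i i1; rewrite i3.
by have := k4 i; rewrite hk (leq_trans i1 h3) => /(_ isT); lia.
Qed.

(** * Insertion of biwords *)

Definition col (u : nat) (s : seq (nat * nat)) : seq nat :=
  [seq p.1 | p <- s & p.2 == u].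

Definition Qof (s : seq (nat * nat)) : tableau :=
  foldl (fun Q p => record p.1 Q p.2) [::] s.

(* [run w s P]: inserting the biword w yields P, and s lists the pairs
   (recorded letter, column of the new box) *)
Inductive run : seq (nat * nat) -> seq (nat * nat) -> tableau -> Prop :=
| RunNil : run [::] [::] [::]
| RunRcons w s P a b j P' : run w s P -> valid P -> inserts b P P' j ->
    run (rcons w (a, b)) (rcons s (a, j)) P'.

Lemma col_rcons u s p :
  col u (rcons s p) = if p.2 == u then rcons (col u s) p.1 else col u s.
Proof. by rewrite /col filter_rcons; case: ifP => // _; rewrite map_rcons. Qed.

Lemma nth_Qof u s : nth [::] (Qof s) u = col u s.
Proof.
elim/last_ind: s => [|s p IH]; first by rewrite nth_nil.
rewrite /Qof foldl_rcons -/(Qof s) /record nth_set_nth /= col_rcons -IH.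
by rewrite eq_sym; case: eqP => [->|].
Qed.

Lemma run_valid w s P : run w s P -> valid P.
Proof. by case=> // {}w {}s P0 a b j P' _ h /inserts_valid; apply. Qed.

Lemma valid_colle P u : valid P -> colle (nth [::] P u) (nth [::] P u.+1).
Proof.
elim: P u => [|c P IH] [|u] //=; try by move=> _; rewrite ?nth_nil.
  by case=> _ _; rewrite nth0.
by case=> _ _ _; apply: IH.
Qed.

Lemma valid_size_head P u : valid P -> size (nth [::] P u) <= size (head [::] P).
Proof.
move=> h; rewrite -nth0; elim: u => // u IH.
by apply: leq_trans IH; case: (valid_colle u h).
Qed.

Lemma run_shape w s P u : run w s P -> size (nth [::] P u) = size (col u s).
Proof.
elim=> {w s P} [|w s P a b j P' _ IH _ hi]; first by rewrite nth_nil.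
rewrite (inserts_shape u hi) IH col_rcons /= eq_sym.
by case: eqP => _; rewrite ?size_rcons ?addn1 ?addn0.
Qed.

Lemma run_fst w s P : run w s P -> map fst w = map fst s.
Proof. by elim=> {w s P} // w s P a b j P' _ IH _ hi; rewrite !map_rcons IH. Qed.

Lemma run_hecke_eq w s P : run w s P ->
  hecke_eq (map snd w) (reading_word P) /\ size w = size (reading_word P).
Proof.
elim=> {w s P} // w s P a b j P' _ [IH1 IH2] _ hi; split; last first.
  by rewrite size_rcons (inserts_size hi) IH2.
rewrite map_rcons; apply: hecke_eq_trans (inserts_hecke_eq hi).
by rewrite -!cats1; apply: hecke_eq_cat.
Qed.

Lemma run_pos w s P : run w s P -> (0 \notin map snd w) = (0 \notin reading_word P).
Proof.
elim=> {w s P} // w s P a b j P' _ IH _ hi.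
by rewrite map_rcons -(inserts_pos hi) !mem_rcons !inE !negb_or IH.
Qed.

Lemma run_tight w s P : run w s P -> tight (map snd w) <-> tight (reading_word P).
Proof.
move=> h; have [e sz] := run_hecke_eq h; have p := run_pos h.
split=> ht; [apply: (tight_hecke_eq (hecke_eq_sym e) _ _ ht)|apply: (tight_hecke_eq e _ _ ht)];
  rewrite ?size_map //.
  by rewrite -p; case: ht.
by rewrite p; case: ht.
Qed.

Lemma run_foldl w s P : run w s P ->
  foldl eg_step ([::], [::]) w = (P, Qof s).
Proof.
elim=> {w s P} // w s P a b j P' _ IH _ hi.
by rewrite foldl_rcons IH /eg_step /= (eg_insert_spec hi) /Qof foldl_rcons.
Qed.

Lemma run_exists w : tight (map snd w) -> exists s P, run w s P.
Proof.
elim/last_ind: w => [_|w [a b] IH]; first by exists [::], [::]; constructor.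
rewrite map_rcons => ht; have htw := ht; rewrite -cats1 in htw.
have [s [P hr]] := IH (tight_catl htw).
have hv := run_valid hr; have [e sz] := run_hecke_eq hr.
have [] := @inserts_exists b P hv.
  apply: (tight_hecke_eq _ _ _ ht).
  - by rewrite -!cats1; apply: hecke_eq_cat => //; apply: hecke_eq_sym.
  - by rewrite !size_rcons size_map sz.
  - rewrite mem_rcons inE negb_or -(run_pos hr) -negb_or -in_cons -mem_rcons.
    by case: ht.
by move=> P' [j hi]; exists (rcons s (a, j)), P'; apply: RunRcons hr hv hi.
Qed.

Lemma run_inj w1 w2 s P : run w1 s P -> run w2 s P -> w1 = w2.
Proof.
move=> h; elim: h w2 => {w1 s P} [|w s P a b j P' _ IH hv hi] w2.
  move e : [::] => s h; by case: h e => // w0 [|? ?].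
move es : (rcons s (a, j)) => s' h.
case: w2 s' P' / h es hi => [|w2 s2 P2 a2 b2 j2 P' h2 hv2 hi2]; first by case: (s).
move=> /rcons_inj[e1 e2 e3] hi; subst.
have [e1 e2] := inserts_inj hi hi2 (valid_nonempty hv) (valid_nonempty hv2).
by subst; rewrite (IH _ h2).
Qed.

(** * Semistandard recording tableaux and flags *)

Definition lexlt : rel (nat * nat) := fun p q =>
  (p.1 < q.1) || ((p.1 == q.1) && (p.2 < q.2)).

(* the order in which the biword lists its columns *)
Definition wlt : rel (nat * nat) := fun p q =>
  (p.1 < q.1) || ((p.1 == q.1) && (q.2 < p.2)).

Lemma lexlt_trans : transitive lexlt.
Proof. move=> [a b] [c d] [e f]; rewrite /lexlt /=; lia. Qed.

Lemma lexlt_irr : irreflexive lexlt.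
Proof. move=> [a b]; rewrite /lexlt /=; lia. Qed.

Lemma wlt_trans : transitive wlt.
Proof. move=> [a b] [c d] [e f]; rewrite /wlt /=; lia. Qed.

Lemma wlt_irr : irreflexive wlt.
Proof. move=> [a b]; rewrite /wlt /=; lia. Qed.

Lemma sorted_rcons_all (T : Type) (r : rel T) s x : transitive r ->
  sorted r (rcons s x) = all (r^~ x) s && sorted r s.
Proof. by move=> tr; rewrite !sorted_pairwise // pairwise_rcons. Qed.

(** A semistandard tableau as the list of its pairs (entry, column) in the order of recording: by
    entry, and equal entries from left to right. Strictness of the order gives strictness down the
    columns. *)
Definition ssyt (s : seq (nat * nat)) := sorted lexlt s /\
  forall u i, i < size (col u.+1 s) ->
    i < size (col u s) /\ nth 0 (col u s) i <= nth 0 (col u.+1 s) i.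

Lemma sorted_last_step (T : Type) (r : rel T) s x y : transitive r ->
  sorted r (rcons s x) -> r x y -> sorted r (rcons (rcons s x) y).
Proof.
move=> tr h hxy; rewrite (sorted_rcons_all _ _ tr) h andbT all_rcons hxy /=.
move: h; rewrite (sorted_rcons_all _ _ tr) => /andP[h _].
by apply: sub_all h => z hz; apply: tr hxy.
Qed.

Lemma run_lexlt w s P : run w s P -> sorted wlt w -> sorted lexlt s.
Proof.
elim=> {w s P} // w s P a b j P' hr IH hv hi hs.
case: hr IH hi hs hv => {w s P} // w s P0 a0 b0 j0 P hr hv0 hi0 IH hi hs hv.
apply: sorted_last_step; first exact: lexlt_trans.
  by apply: IH; move: hs; rewrite (sorted_rcons_all _ _ wlt_trans) => /andP[].
move: hs; rewrite (sorted_rcons_all _ _ wlt_trans) all_rcons /= => /andP[/andP[h _] _].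
move: h; rewrite /wlt /lexlt /= => /orP[->//|/andP[-> hb]].
by have [-> //] := inserts_pieri hi0 hi; rewrite orbT.
Qed.

Lemma mem_col x u s : (x \in col u s) = ((x, u) \in s).
Proof.
apply/mapP/idP => [[[a b]]|h]; last by exists (x, u); rewrite ?mem_filter ?eqxx.
by rewrite mem_filter /= => /andP[/eqP -> h] ->.
Qed.

Lemma run_ssyt w s P : run w s P -> sorted wlt w -> ssyt s.
Proof.
move=> hr hs; split; first exact: run_lexlt hr hs.
elim: hr hs => {w s P} // w s P a b j P' hr IH hv hi hs u i.
have hv' := inserts_valid hi hv.
have hs' : sorted wlt w by move: hs; rewrite (sorted_rcons_all _ _ wlt_trans) => /andP[].
have ha v x : x \in col v s -> x <= a.
  rewrite mem_col => hx; have : x \in map fst w.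
    by rewrite (run_fst hr); apply/mapP; exists (x, v).
  move: hs; rewrite (sorted_rcons_all _ _ wlt_trans) => /andP[/allP h _] /mapP[[c d] /h].
  by rewrite /wlt /= => ? ->; lia.
have hr' := RunRcons a hr hv hi.
have szu := run_shape u hr'; have szu' := run_shape u.+1 hr'.
have [szc _] := valid_colle u hv'.
move=> hi'; split; first by rewrite -szu; apply: leq_trans szc; rewrite szu'.
move: hi' szu szu' szc; rewrite !col_rcons /=.
case: (eqVneq j u) => [e|ne].
  subst u; rewrite (_ : j == j.+1 = false); last by lia.
  move=> h1 h2 h3 h4; rewrite nth_rcons.
  have h5 : i < size (col j s).
    by have := inserts_corner hi hv; move: h2; rewrite size_rcons; lia.
  by rewrite h5; case: (IH hs' j i h1).
case: (eqVneq j u.+1) => [e|ne'].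
  move=> h1 h2 h3 h4; rewrite nth_rcons.
  move: h1; rewrite size_rcons ltnS leq_eqVlt => /orP[/eqP e'|h1].
    have h5 : i < size (col u s) by move: h3; rewrite size_rcons; lia.
    by rewrite -e' ltnn eqxx; apply: (ha u); apply: mem_nth.
  by rewrite h1; case: (IH hs' u i h1).
by move=> h1 _ _ _; case: (IH hs' u i h1).
Qed.

Lemma ssyt_inj s1 s2 : sorted lexlt s1 -> sorted lexlt s2 ->
  (forall u, col u s1 = col u s2) -> s1 = s2.
Proof.
move=> h1 h2 h; apply: (irr_sorted_eq lexlt_trans lexlt_irr h1 h2) => -[a u].
by rewrite -!mem_col h.
Qed.

Lemma ssyt_rcons s a j : ssyt (rcons s (a, j)) ->
  ssyt s /\ size (col j.+1 (rcons s (a, j))) < size (col j (rcons s (a, j))).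
Proof.
case=> hs hr; have := hs; rewrite (sorted_rcons_all _ _ lexlt_trans) => /andP[ha hs'].
have key i : i < size (col j.+1 s) -> i < size (col j s).
  move=> hi; have := hr j i; rewrite !col_rcons /= eqxx.
  rewrite (_ : j == j.+1 = false); last by lia.
  move=> /(_ hi)[]; rewrite size_rcons ltnS leq_eqVlt => /orP[/eqP e|//].
  rewrite e nth_rcons ltnn eqxx -e => hle.
  have := mem_nth 0 hi; rewrite mem_col => /(allP ha); rewrite /lexlt /=; lia.
split; last first.
  rewrite !col_rcons /= eqxx (_ : j == j.+1 = false); last by lia.
  rewrite size_rcons ltnS leqNgt; apply/negP => h.
  by have := key _ h; rewrite ltnn.
split=> // u i hi; have := hr u i; rewrite !col_rcons /=.
case: (eqVneq j u) => [e|ne].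
  subst u; rewrite (_ : j == j.+1 = false); last by lia.
  by move=> /(_ hi)[_]; rewrite nth_rcons (key _ hi).
case: (eqVneq j u.+1) => [e|ne'] => [|/(_ hi) //].
rewrite size_rcons ltnS nth_rcons hi => /(_ (ltnW hi)) //.
Qed.

(** The letters come from reverse insertion at the boxes of s, last one first. Within a block of
    equal recorded letters they decrease: a larger letter would have landed weakly to the left by
    [inserts_pieri], and an equal one contradicts tightness. *)
Lemma run_surj s P : ssyt s -> valid P -> tight (reading_word P) ->
  (forall u, size (nth [::] P u) = size (col u s)) ->
  exists w, run w s P /\ sorted wlt w.
Proof.
elim/last_ind: s P => [|s [a j] IH] P hs hv ht hsz.
  exists [::]; split=> //; suff -> : P = [::] by constructor.
  case: P hv ht hsz => // c P [hc _ _ _] _ /(_ 0) /= /size0nil/hc [].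
have [hs' hc] := ssyt_rcons hs; rewrite -!hsz in hc.
have [b [P0 [hi hne]]] := inserts_bwd hv ht hc.
have hv0 := inserts_valid_bwd hi hv hc hne.
have ht' := ht; rewrite -(inserts_tight hi) in ht'.
have ht0 := ht'; rewrite -cats1 in ht0.
have [|w [hr hw]] := IH P0 hs' hv0 (tight_catl ht0).
  move=> u; have := inserts_shape u hi; rewrite hsz col_rcons /= eq_sym.
  by case: eqP => _; rewrite ?size_rcons; lia.
exists (rcons w (a, b)); split; first exact: RunRcons hr hv0 hi.
case: hr hs hi hw ht' => {w s P0 IH hs' hc hsz hne hv0 ht0} // w s P1 a0 b0 j0 P0 hr hv1 hi0.
move=> [hs _] hi hw ht'.
apply: sorted_last_step => //; first exact: wlt_trans.
move: hs; rewrite (sorted_rcons_all _ _ lexlt_trans) all_rcons /= => /andP[/andP[h _] _].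
move: h; rewrite /wlt /lexlt /= => /orP[->//|/andP[-> hj]].
have [_ h] := inserts_pieri hi0 hi; case: (ltngtP b b0) => [|h'|e]; first by rewrite orbT.
  by have := h h'; lia.
exfalso; subst b0.
have e := inserts_hecke_eq hi0; have sz := inserts_size hi0; have ps := inserts_pos hi0.
have : tight (rcons (rcons (reading_word P1) b) b).
  apply: (tight_hecke_eq _ _ _ ht').
  - by rewrite -!(cats1 _ b); apply: hecke_eq_cat => //; rewrite cats1.
  - by rewrite !size_rcons sz.
  - rewrite mem_rcons inE negb_or ps -negb_or -in_cons -mem_rcons.
    by case: ht'.
rewrite -!cats1 -catA => /tight_catr.
by apply: (@tight_repeat _ [::] [::]).
Qed.

(** A chain of three inequalities: a is at most the flag [K + i] of the row of its new box, which is
    at most the first-column entry of that row, which is at most b by [inserts_row_le]. The bound on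
    the first column passes to earlier tableaux because insertion only lowers entries. *)
Lemma run_flag_bwd K w s P : run w s P ->
  (forall i, i < size (head [::] P) -> K + i <= nth 0 (head [::] P) i) ->
  (forall u i, i < size (col u s) -> nth 0 (col u s) i <= K + i) ->
  all (fun p => p.1 <= p.2) w.
Proof.
elim=> {w s P} // w s P a b j P' hr IH hv hi hP hs.
have hv' := inserts_valid hi hv.
rewrite all_rcons /=; apply/andP; split.
  apply: leq_trans (inserts_row_le hi hv'); rewrite (run_shape j hr).
  have := hs j (size (col j s)); rewrite col_rcons /= eqxx size_rcons.
  rewrite nth_rcons ltnn eqxx => /(_ (leqnn _)) h; apply: (leq_trans h).
  apply: hP; apply: leq_trans (valid_size_head j hv').
  by rewrite (inserts_shape j hi) eqxx addn1 (run_shape j hr).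
apply: IH => [i|u i] h.
  rewrite -nth0 in h *; apply: leq_trans (inserts_entry_le hi h).
  rewrite nth0; apply: hP; rewrite -nth0 (inserts_shape 0 hi).
  exact: leq_trans (leq_addr _ _).
have := hs u i; rewrite col_rcons /=; case: ifP => _ /=; last exact.
by rewrite size_rcons nth_rcons h; apply; apply: ltnW.
Qed.

(** In column u, an entry to which the earlier bound no longer applies is at least b + u, hence at
    least a + u, and a is the largest letter recorded so far. *)
Lemma run_flag_fwd w s P : run w s P -> sorted wlt w ->
  all (fun p => p.1 <= p.2) w -> forall u i, i < size (col u s) ->
  nth 0 (col u s) i + u <= nth 0 (nth [::] P u) i.
Proof.
elim=> {w s P} // w s P a b j P' hr IH hv hi hs.
rewrite all_rcons /= => /andP[hab hall] u i hi'.
have hs' : sorted wlt w by move: hs; rewrite (sorted_rcons_all _ _ wlt_trans) => /andP[].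
have ha v x : x \in col v (rcons s (a, j)) -> x <= a.
  rewrite mem_col => hx; have : x \in map fst (rcons w (a, b)).
    by rewrite (run_fst (RunRcons a hr hv hi)); apply/mapP; exists (x, v).
  case/mapP=> -[c d]; rewrite mem_rcons inE => /orP[/eqP [-> _] -> //|].
  move: hs; rewrite (sorted_rcons_all _ _ wlt_trans) => /andP[/allP h _] /h.
  by rewrite /wlt /= => ? ->; lia.
have hi2 := hi'; rewrite -(run_shape u (RunRcons a hr hv hi)) in hi2.
case: (inserts_entry_ge hi hi2) => [[h ->]|h]; last first.
  by apply: leq_trans h; rewrite leq_add2r; apply: leq_trans (ha u _ (mem_nth 0 hi')) hab.
rewrite (run_shape u hr) in h; apply: leq_trans (IH hs' hall u i h).
rewrite leq_add2r col_rcons; case: ifP => // _; by rewrite nth_rcons h.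
Qed.

(** * Ranks of insertion tableaux *)

Definition cnt (S : pred nat) (x : nat) : nat := count S (iota 1 x).

Definition upto (p : nat) : pred nat := fun s => 0 < s <= p.

Lemma cntS S x : cnt S x.+1 = cnt S x + S x.+1.
Proof. by rewrite /cnt -(addn1 x) iotaD count_cat /= addn0 add1n addn1. Qed.

Lemma cnt_add S x d : cnt S (x + d) <= cnt S x + d.
Proof. by elim: d => [|d IH]; rewrite ?addn0 // !addnS cntS; case: (S _); lia. Qed.

Lemma cnt_mono S x y : x <= y -> cnt S x <= cnt S y.
Proof. by move=> /subnK <-; elim: (y - x) => // n IH; rewrite addSn cntS; lia. Qed.

Lemma cnt_upto p x : cnt (upto p) x = minn x p.
Proof.
elim: x => [|x IH]; first by rewrite min0n.
rewrite cntS IH /upto /=; lia.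
Qed.

(** The count at b drops to the least value compatible with its two neighbours; no other count
    changes. *)
Lemma cnt_bubble b S x : 0 < b -> cnt (bubble b S) x =
  if x == b then maxn (cnt S b.-1) (cnt S b.+1).-1 else cnt S x.
Proof.
case: b => // b _; elim: x => [//|x IH]; rewrite cntS IH.
rewrite /bubble /= !eqSS; have [->|ne] := eqVneq x b.
  rewrite (_ : b == b.+1 = false); last by lia.
  by rewrite !cntS; case: (S b.+1); case: (S b.+2) => /=; lia.
have [->|ne'] := eqVneq x b.+1; last by rewrite cntS.
by rewrite !cntS; case: (S b.+1); case: (S b.+2) => /=; lia.
Qed.

Lemma cnt_bubbles_id v S x : 0 \notin v -> x \notin v -> cnt (bubbles v S) x = cnt S x.
Proof.
elim: v => //= b v IH; rewrite !inE !negb_or => /andP[b0 v0] /andP[xb xv].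
by rewrite cnt_bubble ?(negbTE xb) ?IH //; lia.
Qed.

(** In a decreasing word the smaller letters act first: when x acts, the count at x - 1 is already
    final and the count at x + 1 is still the old one. In [cnt_column] the roles are exchanged. *)
Lemma cnt_row l S x : sorted gtn l -> 0 \notin l -> cnt (bubbles l S) x =
  if x \in l then maxn (cnt (bubbles l S) x.-1) (cnt S x.+1).-1 else cnt S x.
Proof.
elim: l => // b l IH hs; rewrite inE negb_or => /andP[b0 l0].
have hb : all (gtn b) l.
  by apply: (order_path_min (leT := gtn)) => //; move=> ? ? ? /=; lia.
have hnot y : b <= y -> y \notin l by move=> h; apply/negP => /(allP hb) /=; lia.
have hlt y : y \in l -> y < b by move/(allP hb).
rewrite inE /= cnt_bubble; last by lia.
have [->|ne] /= := eqVneq x b.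
  rewrite cnt_bubble; last by lia.
  rewrite (_ : b.-1 == b = false); last by lia.
  by rewrite (@cnt_bubbles_id l S b.+1) // hnot; lia.
rewrite IH //; last exact: path_sorted hs.
case: ifP => // hx; rewrite cnt_bubble; last by lia.
by rewrite (_ : x.-1 == b = false) //; have := hlt _ hx; lia.
Qed.

Lemma cnt_column l S x : sorted ltn l -> 0 \notin l -> cnt (bubbles l S) x =
  if x \in l then maxn (cnt S x.-1) (cnt (bubbles l S) x.+1).-1 else cnt S x.
Proof.
elim: l => // b l IH hs; rewrite inE negb_or => /andP[b0 l0].
have hb := sorted_lt_head hs.
have hnot y : y <= b -> y \notin l by move=> h; apply/negP => /(allP hb) /=; lia.
have hlt y : y \in l -> b < y by move/(allP hb).
rewrite inE /= cnt_bubble; last by lia.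
have [->|ne] /= := eqVneq x b.
  rewrite cnt_bubble; last by lia.
  rewrite (_ : b.+1 == b = false); last by lia.
  by rewrite (@cnt_bubbles_id l S b.-1) // hnot; lia.
rewrite IH //; last exact: path_sorted hs.
case: ifP => // hx; rewrite cnt_bubble; last by lia.
by rewrite (_ : x.+1 == b = false) //; have := hlt _ hx; lia.
Qed.

Lemma reading_word_rcons T c : reading_word (rcons T c) = c ++ reading_word T.
Proof. by elim: T => [|d T IH] /=; rewrite ?cats0 // IH catA. Qed.

Lemma reading_word_cat T U : reading_word (T ++ U) = reading_word U ++ reading_word T.
Proof. by elim: T => [|d T IH] /=; rewrite ?cats0 // IH catA. Qed.

Lemma reading_word_take_S P j : reading_word (take j.+1 P) = nth [::] P j ++ reading_word (take j P).
Proof.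
case: (ltnP j (size P)) => h; first by rewrite (take_nth [::] h) reading_word_rcons.
by rewrite nth_default // !take_oversize // ltnW.
Qed.

Lemma valid_drop P j : valid P -> valid (drop j P).
Proof. by elim: j P => [|j IH] [|c P] //= [_ _ _ /IH]. Qed.

Lemma valid_sorted P u : valid P -> sorted ltn (nth [::] P u).
Proof.
by move=> /(valid_drop u)/valid_head; rewrite -nth0 nth_drop addn0.
Qed.

Lemma mem_reading_word P x : x \in reading_word P -> exists2 u, u < size P & x \in nth [::] P u.
Proof.
elim: P => //= c P IH; rewrite mem_cat => /orP[/IH[u h1 h2]|h].
  by exists u.+1.
by exists 0.
Qed.

Lemma nth_reading_word P u x : x \in nth [::] P u -> x \in reading_word P.
Proof.
elim: P u => [|c P IH] [|u] //=; rewrite mem_cat; first by move=> ->; rewrite orbT.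
by move/IH => ->.
Qed.

Lemma valid_entry_gt P u i : valid P -> 0 \notin reading_word P ->
  i < size (nth [::] P u) -> u < nth 0 (nth [::] P u) i.
Proof.
move=> hv h0; elim: u => [|u IH] h.
  rewrite lt0n; apply/eqP => e; move/negP: h0; apply.
  by have := mem_nth 0 h; rewrite e; apply: nth_reading_word.
have [h1 h2] := valid_colle u hv.
by apply: leq_ltn_trans (IH (leq_trans h h1)) (h2 i h).
Qed.

Lemma colle_count c d y : colle c d ->
  count (leq^~ y.+1) d <= count (leq^~ y) c.
Proof.
elim: c d => [|c0 c IH] [|d0 d] [] h1 h2 /=; try by [].
apply: leq_add; last by apply: IH; split=> // i hi; apply: (h2 i.+1).
have /= := h2 0 isT; case: (leqP c0 y) => //=; lia.
Qed.

Lemma count_leqS (c : seq nat) y :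
  count (leq^~ y.+1) c = count (leq^~ y) c + count_mem y.+1 c.
Proof.
by elim: c => //= a c ->; case: (ltngtP a y.+1) => /=; lia.
Qed.

Lemma count_leq_sorted c m i : sorted ltn c -> i < count (leq^~ m) c ->
  i < size c /\ nth 0 c i <= m.
Proof.
elim: c i => // a c IH i hs /=; case: i => [|i] h.
  split=> //=; case: (leqP a m) h => //= h.
  rewrite -has_count => /hasP[x /(allP (sorted_lt_head hs))] /=; lia.
have [|h1 h2] := IH i (path_sorted hs); last by [].
by move: h; case: (a <= m); lia.
Qed.

Lemma count_leq_le (c : seq nat) m n :
  (forall i, n <= i < size c -> m < nth 0 c i) -> count (leq^~ m) c <= n.
Proof.
move=> h; rewrite -{1}(cat_take_drop n c) count_cat.
rewrite [X in _ + X](_ : _ = 0) ?addn0.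
  by apply: leq_trans (count_size _ _) _; rewrite size_take_min geq_minl.
apply/eqP; rewrite -leqn0 leqNgt -has_count; apply/negP => /hasP[x /(nthP 0)[i]].
rewrite size_drop nth_drop => hi <- /= hle.
suff : m < nth 0 c (n + i) by rewrite ltnNge hle.
apply: h; rewrite leq_addr -ltn_subRL. exact: hi.
Qed.

Lemma crossing (f : nat -> nat) m x p : x <= p -> f x <= m -> m < f p ->
  exists y, [/\ x <= y, y < p, f y <= m & m < f y.+1].
Proof.
move=> hxp h1; elim: p hxp => [|p IH] hxp h2.
  by move: hxp h1; rewrite leqn0 => /eqP ->; lia.
move: hxp; rewrite leq_eqVlt => /orP[/eqP e|hxp]; first by subst x; lia.
case: (leqP (f p) m) => h; first by exists p.
by have [y [? ? ? ?]] := IH hxp h; exists y; split=> //; lia.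
Qed.

(* The letter r + u in the column u (from 0) of P is a cross of a pipe dream in
   row r and column u + 1; [free P u x] counts the boxes without cross among the
   first x boxes of this column. *)
Definition free (P : tableau) u x :=
  x - count (leq^~ (x + u)) (nth [::] P u).

Lemma free_col P u x : valid P -> free P u x <= free P u.+1 x.
Proof.
by move=> h; rewrite /free addnS leq_sub2l //; apply/colle_count/valid_colle.
Qed.

Lemma free_S P u x : free P u x.+1 <= (free P u x).+1.
Proof. by rewrite /free addSn count_leqS; lia. Qed.

Lemma free_lt P u x : free P u x < free P u x.+1 -> x.+1 + u \notin nth [::] P u.
Proof.
rewrite /free addSn count_leqS => h; apply/negP => h'.
by move: h; rewrite -[count_mem _ _]prednK -?has_count ?has_pred1 //; lia.
Qed.

Section Rank.
Variables (P : tableau) (S : pred nat).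
Hypotheses (hv : valid P) (h0 : 0 \notin reading_word P).

(** The index is shifted by j so that x remains a number of rows: in column j, row x + 1 carries the
    letter x + 1 + j. *)
Let N j x := cnt (bubbles (reading_word (take j P)) S) (x + j).

Lemma col_pos j : 0 \notin nth [::] P j.
Proof. by apply: contra h0; apply: nth_reading_word. Qed.

Lemma column_rank_free j x : x.+1 + j \notin nth [::] P j -> N j.+1 x = N j x.+1.
Proof.
move=> h; rewrite /N reading_word_take_S bubbles_cat cnt_column ?valid_sorted ?col_pos //.
by rewrite addnS -addSn (negbTE h).
Qed.

Lemma column_rank_col j x : N j x <= N j.+1 x.
Proof.
rewrite /N reading_word_take_S bubbles_cat (@cnt_column (nth [::] P j)) ?valid_sorted ?col_pos //.
by case: ifP => _; rewrite addnS /=; [exact: leq_maxl|apply: cnt_mono].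
Qed.

Lemma column_rank_cols i j x : i <= j -> N i x <= N j x.
Proof.
by move=> /subnK <-; elim: (j - i) => // n IH; apply: leq_trans IH (column_rank_col _ _).
Qed.

Lemma column_rank_row j x y : x <= y -> N j y <= N j x + (y - x).
Proof.
by move=> h; rewrite /N -{1}(subnKC h) addnAC cnt_add.
Qed.

(** This follows a greedy north-east chain, which uses in column j0 + t the free box of rank n - t
    from the top. By [free_col] and [free_S] these boxes move strictly upwards, and by
    [column_rank_free] each of them adds one to the surplus s present before column j0. *)
Lemma rank_chain j0 p s n : (forall y, y <= p -> y + s <= N j0 y) ->
  n <= free P j0 p -> s + n <= N (j0 + n) 0.
Proof.
move=> hb hn.
have hfree t : n <= free P (j0 + t) p.
  elim: t => [|t IH]; first by rewrite addn0.
  by rewrite addnS; apply: leq_trans IH (free_col _ _ hv).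
suff H t x : t <= n -> x <= p -> (if t is t'.+1 then free P (j0 + t') x <= n - t else true) ->
    x + s + t <= N (j0 + t) x.
  have := H n 0 (leqnn _) (leq0n _); rewrite add0n; apply.
  by case: (n).
elim: t x => [|t IH] x ht hx hf; first by rewrite !addn0; apply: hb.
have [y [y1 y2 y3 y4]] : exists y, [/\ x <= y, y < p, free P (j0 + t) y <= n - t.+1 &
    n - t.+1 < free P (j0 + t) y.+1].
  by apply: crossing => //; apply: leq_trans (hfree t); lia.
have hN := column_rank_free (free_lt (leq_ltn_trans y3 y4)).
have h : y.+1 + s + t <= N (j0 + t) y.+1.
  apply: IH => //; first exact: ltnW.
  case: (t) ht y3 {hN} => // t' ht y3.
  have h1 := free_col (j0 + t') y.+1 hv.
  have h2 := free_S P (j0 + t'.+1) y.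
  rewrite -(addnS j0 t') in h1; clear - h1 h2 y3 ht.
  lia.
have h' := column_rank_row (j0 + t).+1 y1; rewrite hN in h'; rewrite (addnS j0 t); lia.
Qed.

(** Entries of column u exceed u, so the columns from index q on do not contain the letter q and
    leave the count at q unchanged. *)
Lemma cnt_take q : cnt (bubbles (reading_word P) S) q = cnt (bubbles (reading_word (take q P)) S) q.
Proof.
rewrite -{1}(cat_take_drop q P) reading_word_cat bubbles_cat cnt_bubbles_id //.
  by apply: contra h0; rewrite -{2}(cat_take_drop q P) reading_word_cat mem_cat => ->.
apply/negP => /mem_reading_word[u _]; rewrite nth_drop => /(nthP 0)[i hi e].
by have := valid_entry_gt hv h0 hi; rewrite e; lia.
Qed.

End Rank.

Section Uniqueness.
Variables (P : tableau) (k : nat) (mu : pred (nat * nat)).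
Hypotheses (hv : valid P) (h0 : 0 \notin reading_word P).
Hypothesis mu_pos : forall i j, mu (i, j) -> 0 < i /\ 0 < j.
Hypothesis rank : forall i j, mu (i, j) ->
  cnt (bubbles (reading_word P) (upto (i + k))) (j + k) <= k.

Lemma base_rank p j y : y <= p -> y <= cnt (bubbles (reading_word (take j P)) (upto p)) (y + j).
Proof.
move=> h; apply: leq_trans (column_rank_cols (upto p) hv h0 y (leq0n j)).
by rewrite take0 /= addn0 cnt_upto; lia.
Qed.

(** With fewer than i letters in its first i + k rows, column j would have k + 1 free boxes there,
    and [rank_chain] would produce rank k + 1 at (i + k, j + k). *)
Lemma rank_shape i j : mu (i, j) -> i <= size (nth [::] P j.-1) /\
  nth 0 (nth [::] P j.-1) i.-1 <= k + i + j.-1.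
Proof.
move=> h; have [hi hj] := mu_pos h; have hr := rank h.
have hc : i.-1 < count (leq^~ (k + i + j.-1)) (nth [::] P j.-1).
  rewrite ltnNge; apply/negP => hc.
  have := @rank_chain P (upto (i + k)) hv h0 j.-1 (i + k) 0 k.+1.
  rewrite add0n (_ : j.-1 + k.+1 = j + k); last by lia.
  move=> /(_ _ _)/leq_trans; rewrite add0n -cnt_take // => H.
  suff : k.+1 <= k by rewrite ltnn.
  apply: H => //; first by move=> y hy; rewrite addn0 base_rank.
  by rewrite /free (addnC i k); lia.
have [] := count_leq_sorted (valid_sorted _ hv) hc; lia.
Qed.

Hypothesis shape : forall i j, 0 < i <= size (nth [::] P j) -> mu (i, j.+1).

Lemma rank_unique u i : i < size (nth [::] P u) ->
  nth 0 (nth [::] P u) i = k + i.+1 + u.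
Proof.
move=> hi; apply/eqP; rewrite eqn_leq; apply/andP; split.
  by have := rank_shape (shape (i := i.+1) (j := u) hi) => -[].
(* The lower bound goes by induction from the rightmost column: n bounds the number of columns from
   u on. *)
have [n hn] : exists n, size P <= u + n by exists (size P); lia.
elim: n u i hn hi => [|n IH] u i hn hi.
  by move: hi; rewrite nth_default //; lia.
set c := nth [::] P u in hi *.
(* Let m be the last row whose entry is too small. The entry after it, if any, is not too small, so
   the letter k + m + 1 + u is missing from the column, and the box of row k + m + 1 is free. *)
pose bad := [pred i | (i < size c) && (nth 0 c i < k + i.+1 + u)].
rewrite leqNgt; apply/negP => hbad.
have exb : exists m, bad m by exists i; apply/andP.
have ubb m : bad m -> m <= size c by move=> /andP[h _]; exact: (ltnW h).
case: (ex_maxnP exb ubb) => m /andP[hm hm'] hmax.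
have hmu := shape (i := m.+1) (j := u) hm.
have hnc : k + m.+1 + u \notin c.
  apply/negP => /(nthP 0)[t ht]; rewrite -/c => e.
  have {}e : nth 0 c t = k + m.+1 + u := e; have {}ht : t < size c := ht.
  have {}hm' : nth 0 c m < k + m.+1 + u := hm'.
  have tm : m < t.
    case: (ltngtP m t) => // [h|h]; last by subst t; lia.
    by have := sorted_nth_lt (valid_sorted u hv) h hm; rewrite -/c; lia.
  have mt : m.+1 < size c by lia.
  have : ~~ bad m.+1 by apply/negP => /hmax; rewrite ltnn.
  rewrite /= mt /= -leqNgt => h.
  move: tm; rewrite leq_eqVlt => /orP[/eqP e'|tm]; first by subst t; lia.
  by have := sorted_nth_lt (valid_sorted u hv) tm ht; rewrite -/c; lia.
(* The free box just found gives the surplus 1 in front of column u + 1. There, by induction, at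
   most m letters fall in the first m + k rows, so k of these boxes are free; the total k + 1
   contradicts [rank]. *)
have := @rank_chain P (upto (m.+1 + k)) hv h0 u.+1 (m + k) 1 k.
have hr := rank hmu.
rewrite -cnt_take // => H; suff : 1 + k <= k by rewrite ltnn.
apply: leq_trans hr; apply: H.
  move=> y hy; have := column_rank_row P (upto (m.+1 + k)) u.+1 hy.
  rewrite column_rank_free //; last by rewrite -addSn (addnC m.+1 k).
  have := @base_rank (m.+1 + k) u (m + k).+1; rewrite addSn leqnn => /(_ isT).
  by rewrite addSn; lia.
rewrite /free; suff : count (leq^~ (m + k + u.+1)) (nth [::] P u.+1) <= m by lia.
apply: count_leq_le => t /andP[t1 t2].
have := IH u.+1 t; rewrite addSn -addnS => /(_ hn t2); lia.
Qed.

End Uniqueness.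

(** * North-east chains and ranks *)

Lemma mem_boxes l b : (b \in boxes l) =
  [&& 0 < b.1, 0 < b.2 & b.2 <= nth 0 l b.1.-1].
Proof.
case: b => i j; apply/allpairsPdep/idP => [[x [y [hx hy [-> ->]]]]|/= /and3P[hi hj h]].
  by move: hx hy; rewrite !mem_iota /=; lia.
exists i, j; rewrite !mem_iota; split=> //; last by lia.
by rewrite hi /= add1n ltnS; case: (leqP i (size l)) => // h'; move: h; rewrite nth_default; lia.
Qed.

Lemma nth_ferrers l i j : is_ferrers l -> i <= j -> nth 0 l j <= nth 0 l i.
Proof.
move=> h hij; case: (ltnP j (size l)) => hj; last by rewrite nth_default.
have tr : transitive geq by move=> ? ? ? /=; lia.
have rf : reflexive geq by move=> x /=; apply: leqnn.
have /= := sorted_leq_nth tr rf 0 h; apply; rewrite ?inE //; exact: leq_ltn_trans hij hj.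
Qed.

Lemma boxes_closed l b b' : is_ferrers l -> b \in boxes l ->
  0 < b'.1 <= b.1 -> 0 < b'.2 <= b.2 -> b' \in boxes l.
Proof.
case: b b' => [i j] [i' j']; rewrite !mem_boxes /= => h /and3P[h1 h2 h3] h4 h5.
have h6 : nth 0 l i.-1 <= nth 0 l i'.-1 by apply: nth_ferrers => //; lia.
lia.
Qed.

Lemma boxes_uniq l : uniq (boxes l).
Proof.
apply: allpairs_uniq_dep; first exact: iota_uniq.
  by move=> x _; apply: iota_uniq.
by move=> [x y] [x' y'] _ _ /= [-> ->].
Qed.

Section Ferrers.
Variables (la : seq nat) (k : nat).
Hypothesis hla : is_ferrers la.

Lemma nth_inner i : nth 0 (inner k la) i = nth 0 la (i + k) - k.
Proof.
rewrite addnC -nth_drop /inner.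
have : is_ferrers (drop k la).
  exact: drop_sorted.
elim: (drop k la) i => [|x l IH] i hs /=; first by rewrite !nth_nil.
have hs' : is_ferrers l by apply: path_sorted hs.
case: ltnP => h; first by case: i => [|i] //=; apply: IH.
rewrite filter_none ?nth_nil /=; last first.
  move=> z /(nthP 0)[j hj <-]; rewrite -leqNgt.
  by apply: leq_trans h; apply: (@nth_ferrers (x :: l) 0 j.+1).
case: i => [|i] /=; first by lia.
by have := @nth_ferrers (x :: l) 0 i.+1 hs (leq0n _) => /=; lia.
Qed.

Lemma mem_inner i j : ((i, j) \in boxes (inner k la)) =
  [&& 0 < i, 0 < j & (i + k, j + k) \in boxes la].
Proof.
rewrite !mem_boxes /= nth_inner.
case: i => [//|i]; case: j => [//|j] /=.
by rewrite !addSn /=; lia.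
Qed.

Lemma inner_ferrers : is_ferrers (inner k la).
Proof.
apply/(sortedP 0) => i hi /=; rewrite !nth_inner leq_sub2r //.
by apply: nth_ferrers => //; lia.
Qed.

End Ferrers.

Definition row (a : nat) (w : seq (nat * nat)) := [seq p.2 | p <- w & p.1 == a].

Definition below (a : nat) (w : seq (nat * nat)) :=
  [seq p.2 | p <- w & a <= p.1].

Lemma below_row a w : sorted wlt w -> below a w = row a w ++ below a.+1 w.
Proof.
rewrite /below /row; elim: w => //= p w IH hs.
have hs' := path_sorted hs; case: (ltngtP p.1 a) => h /=; [exact: IH| |by rewrite IH].
rewrite (IH hs') (@filter_none _ (fun q => q.1 == a)) //.
move=> [c d] hq; have := order_path_min wlt_trans hs => /allP/(_ _ hq).
rewrite /wlt /=; lia.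
Qed.

Lemma mem_row a w x : (x \in row a w) = ((a, x) \in w).
Proof.
apply/mapP/idP => [[[b c]]|h]; last by exists (a, x); rewrite ?mem_filter ?eqxx.
by rewrite mem_filter /= => /andP[/eqP -> h] ->.
Qed.

Lemma row_sorted a w : sorted wlt w -> sorted gtn (row a w).
Proof.
move=> h; rewrite sorted_map.
have := sorted_filter wlt_trans (fun p => p.1 == a) h.
apply: sub_in_sorted (allss _) => p q; rewrite !mem_filter /wlt /relpre /=.
lia.
Qed.

Section Chains.
Variables (w : seq (nat * nat)) (p : nat).
Hypothesis hs : sorted wlt w.
Hypothesis hw : all (fun x => 0 < x.1 <= x.2) w.

Let T a := bubbles (below a w) (upto p).

Definition elbow (b : nat * nat) := (b.1, b.1 + b.2 - 1) \notin w.

Lemma rank_row a x : cnt (T a) x =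
  if (a, x) \in w then maxn (cnt (T a) x.-1) (cnt (T a.+1) x.+1).-1
  else cnt (T a.+1) x.
Proof.
rewrite /T (below_row a hs) bubbles_cat (@cnt_row (row a w)) ?mem_row //.
  exact: row_sorted.
by apply/negP => /(allP hw) /=; lia.
Qed.

(** Letters of row a are at least a, so the rows below p only sort pairs of positions that are both
    empty. *)
Lemma rank_beyond a : p < a -> T a = upto p.
Proof.
move=> h; have : all (ltn p) (below a w).
  apply/allP => x /mapP[[b c]]; rewrite mem_filter => /andP[/= hb /(allP hw) /=] hc ->.
  by rewrite /=; lia.
rewrite /T; elim: (below a w) => //= b v IH /andP[hb hv]; rewrite IH //.
by apply: funext => x; rewrite /bubble /upto; bubble_cases.
Qed.

Lemma rank_drop a x : cnt (T a.+1) x.+1 <= (cnt (T a) x).+1.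
Proof.
rewrite (rank_row a x); case: ifP => _; last by rewrite cntS; case: (T _ _); lia.
lia.
Qed.

Lemma rank_drops a d x : cnt (T (a + d)) (x + d) <= cnt (T a) x + d.
Proof.
elim: d a x => [|d IH] a x; first by rewrite !addn0.
by rewrite !addnS -!addSn; apply: leq_trans (IH _ _) _; have := rank_drop a x; lia.
Qed.

Lemma below1 : below 1 w = map snd w.
Proof. by rewrite /below filter_id_in // => x /(allP hw) /andP[]. Qed.

Lemma chain_rank c q : sorted ne_step c ->
  all (fun b => [&& 0 < b.1, b.1 <= p, 0 < b.2, b.2 <= q & elbow b]) c ->
  size c <= cnt (bubbles (map snd w) (upto p)) q.
Proof.
rewrite -below1 -/(T 1).
have trans : transitive ne_step by move=> ? ? ? /=; rewrite /ne_step; lia.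
case/lastP: c => // c b; rewrite all_rcons => hc /andP[/and5P[b1 b2 b3 b4 b5] ha].
(* The summand [b.1.-1] pays for the rows above b, each of which may lower the rank by one. *)
suff : b.1.-1 + size (rcons c b) <= cnt (T b.1) (b.1 + b.2 - 1).
  have := rank_drops 1 b.1.-1 b.2; rewrite add1n prednK //.
  rewrite (_ : b.2 + b.1.-1 = b.1 + b.2 - 1); last by lia.
  by have := cnt_mono (T 1) b4; lia.
elim/last_ind: c b hc ha b1 b2 b3 b4 b5 => [|c b' IH] b hc ha b1 b2 b3 b4 b5;
  rewrite rank_row (negbTE b5) size_rcons addnS.
  have h1 := rank_drops b.1.+1 (p - b.1) b.1.
  rewrite addSn !subnKC // (@rank_beyond p.+1) // cnt_upto minnn in h1.
  have h2 : cnt (T b.1.+1) b.1 <= cnt (T b.1.+1) (b.1 + b.2 - 1).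
    by apply: cnt_mono; lia.
  by move=> /=; lia.
move: hc; rewrite (sorted_rcons_all _ _ trans) all_rcons => /andP[/andP[/andP[/= h1 h2] _] hc'].
move: ha; rewrite all_rcons => /andP[/and5P[c1 c2 c3 c4 c5] ha].
have {}IH := IH _ hc' ha c1 c2 c3 c4 c5.
have h3 := rank_drops b.1.+1 (b'.1 - b.1.+1) (b'.2 + b.1).
rewrite subnKC // (_ : b'.2 + b.1 + (b'.1 - b.1.+1) = b'.1 + b'.2 - 1) in h3;
  last by lia.
have h4 : cnt (T b.1.+1) (b'.2 + b.1) <= cnt (T b.1.+1) (b.1 + b.2 - 1).
  by apply: cnt_mono; lia.
lia.
Qed.

Lemma rank_chain_exists q : exists c, [/\ sorted ne_step c,
  all (fun b => [&& 0 < b.1, b.1 <= p, 0 < b.2, b.2 <= q & elbow b]) c &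
  cnt (bubbles (map snd w) (upto p)) q <= size c].
Proof.
rewrite -below1 -/(T 1).
suff H n a x : 0 < a -> a + n = p.+1 -> exists c, [/\ sorted ne_step c,
    all (fun b => [&& a <= b.1, b.1 <= p, 0 < b.2, b.2 <= x & elbow b]) c &
    cnt (T a) (x + a.-1) <= a.-1 + size c].
  have [//|c [h1 h2 h3]] := H p 1 q isT; exists c; split=> //.
  by rewrite addn0 in h3.
elim: n a x => [|n IH] a x ha hn.
  exists [::]; split=> //; rewrite rank_beyond; last by lia.
  by rewrite cnt_upto; lia.
elim: x => [|x IHx].
  by exists [::]; split=> //; have := cnt_add (T a) 0 a.-1; rewrite !add0n addn0.
(* An elbow at (a, x + 1) extends a chain found in the rows below a and the first x columns. At a
   cross, the larger term of the maximum in [rank_row] tells whether to discard column x + 1 or row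
   a. *)
case hx : ((a, a + x) \in w); last first.
  have [//|//|c [h1 h2 h3]] := IH a.+1 x; first by lia.
  exists (rcons c (a, x.+1)); split.
  - have trans : transitive ne_step by move=> ? ? ? /=; rewrite /ne_step; lia.
    rewrite (sorted_rcons_all _ _ trans) h1 andbT; apply: sub_all h2 => b.
    by rewrite /ne_step /=; lia.
  - have he : elbow (a, x.+1) by rewrite /elbow /= addnS subn1 /= hx.
    rewrite all_rcons he /= leqnn /= andbT; apply/andP; split; first by lia.
    by apply: sub_all h2 => b /and5P[? ? ? ? ->]; lia.
  - rewrite size_rcons rank_row (_ : x.+1 + a.-1 = a + x); last by lia.
    by rewrite hx; move: h3; rewrite (_ : x + a.+1.-1 = a + x) /=; lia.
case: (leqP (cnt (T a) (x.+1 + a.-1)) (cnt (T a) (x + a.-1))) => h.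
  have [c [h1 h2 h3]] := IHx; exists c; split=> //; last by lia.
  by apply: sub_all h2 => b /and5P[-> -> -> ? ->]; lia.
have [//|//|c [h1 h2 h3]] := IH a.+1 x.+1; first by lia.
exists c; split=> //; first by apply: sub_all h2 => b /and5P[? -> -> -> ->]; lia.
move: h; rewrite (rank_row a (x.+1 + a.-1)) (_ : x.+1 + a.-1 = a + x); last by lia.
rewrite hx (_ : (a + x).-1 = x + a.-1); last by lia.
move: h3; rewrite (_ : x.+1 + a.+1.-1 = (a + x).+1); last by lia.
by rewrite /=; lia.
Qed.

End Chains.

Definition rank_bounded (la : seq nat) (k : nat) (v : seq nat) :=
  forall p q, (p, q) \in boxes la -> cnt (bubbles v (upto p)) q <= k.

(** The rectangle spanned by a north-east chain lies in la as soon as its south-east corner does,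
    and this corner has the row of the first box and the column of the last. So it suffices to bound
    ranks at the boxes (p, q) of la. *)
Lemma chain_free_rank la k w (F : {fset nat * nat}) : is_ferrers la ->
  sorted wlt w -> all (fun x => 0 < x.1 <= x.2) w ->
  {subset F <= boxes la} -> {in boxes la, forall b, (b \in F) = elbow w b} ->
  chain_free ne_step la k F <-> rank_bounded la k (map snd w).
Proof.
move=> hla hs hw hF hFw; split=> [[_ hfree] p q hpq|hr].
  have [c [h1 h2 h3]] := rank_chain_exists p hs hw q.
  rewrite leqNgt; apply/negP => hk; apply: hfree; exists (take k.+1 c).
  have hsz : size (take k.+1 c) = k.+1 by rewrite size_takel //; apply: leq_trans h3.
  have sub : {subset take k.+1 c <= c} by move=> b /mem_take.
  have hla' b : b \in c -> b \in boxes la.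
    move=> /(allP h2) /and5P[b1 b2 b3 b4 _]; apply: (boxes_closed hla hpq);
    by rewrite /= ?b1 ?b2 ?b3 ?b4.
  split=> //; last first.
    by move=> b /sub hb; rewrite hFw ?hla' //; move/(allP h2): hb => /and5P[].
  split; first by move=> b /sub /hla'.
    exact: take_sorted.
  move=> b /and4P[/hasP[x1 x1c x1b] /hasP[x2 x2c x2b] /hasP[x3 x3c x3b] /hasP[x4 x4c x4b]].
  move: x1c x2c x3c x4c => /sub/(allP h2)/and5P[? ? ? ? _] /sub/(allP h2)/and5P[? ? ? ? _].
  move=> /sub/(allP h2)/and5P[? ? ? ? _] /sub/(allP h2)/and5P[? ? ? ? _].
  by apply: (boxes_closed hla hpq) => /=; lia.
split=> // -[c [[c1 c2 c3] hsz hcF]].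
case: c hsz c1 c2 c3 hcF => // b c hsz c1 c2 c3 hcF.
have trans : transitive ne_step by move=> ? ? ? /=; rewrite /ne_step; lia.
have hlast x : x \in b :: c -> (x.1 <= b.1) && (x.2 <= (last b c).2).
  move=> hx; apply/andP; split.
    move: hx; rewrite inE => /orP[/eqP ->//|/(allP (order_path_min trans c2))].
    by move=> /andP[/ltnW].
  case/lastP: c c2 hx {hsz c1 c3 hcF} => [|c y] c2; first by rewrite inE => /eqP ->.
  rewrite last_rcons -rcons_cons mem_rcons inE => /orP[/eqP ->//|hx].
  have : sorted ne_step (rcons (b :: c) y) by [].
  by rewrite (sorted_rcons_all _ _ trans) => /andP[/allP/(_ x hx)/andP[_ /ltnW]].
have hpq : (b.1, (last b c).2) \in boxes la.
  apply: c3; apply/and4P; split; apply/hasP.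
  - by exists b => //; rewrite inE eqxx.
  - by exists b => //; rewrite inE eqxx.
  - by exists (last b c) => //; apply: mem_last.
  - by exists (last b c) => //; apply: mem_last.
have := @chain_rank w b.1 hs hw (b :: c) (last b c).2 c2.
rewrite hsz => /(_ _)/leq_trans h; suff : k.+1 <= k by rewrite ltnn.
apply: h; last exact: hr.
apply/allP => x hx; have := hlast x hx => /andP[-> ->].
have hxl := c1 x hx; rewrite -hFw // (hcF x hx).
by move: hxl; rewrite mem_boxes => /and3P[-> ->].
Qed.

(** * Reading biwords of fillings *)

Lemma allpairs_sorted (f : nat -> seq nat) (r1 r2 : rel nat) s :
  pairwise r1 s -> (forall x, pairwise r2 (f x)) ->
  pairwise (fun p q => r1 p.1 q.1 || ((p.1 == q.1) && r2 p.2 q.2))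
    [seq (x, y) | x <- s, y <- f x].
Proof.
move=> hs hf; elim: s hs => //= x s IH /andP[hx hs].
rewrite pairwise_cat IH // andbT; apply/andP; split.
  apply/allrelP => -[a b] [c d] /mapP[y _ [-> _]] /allpairsPdep[z [t [hz _ [-> _]]]] /=.
  by rewrite (allP hx).
rewrite pairwise_map; apply: sub_pairwise (hf x) => y z /= ->.
by rewrite eqxx orbT.
Qed.

Lemma biword_sorted la F : sorted wlt (biword la F).
Proof.
rewrite (sorted_pairwise wlt_trans) /biword pairwise_map.
set s := [seq (r, c) | r <- _, c <- _].
have hp : pairwise wlt s.
  apply: (@allpairs_sorted _ ltn gtn); last first.
    move=> x; rewrite -sorted_pairwise; last by move=> ? ? ? /=; lia.
    by rewrite rev_sorted; apply: iota_ltn_sorted.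
  by rewrite -(sorted_pairwise ltn_trans) iota_ltn_sorted.
have hc : all (fun b => 0 < b.2) s.
  apply/allP => b /allpairsPdep[x [y [_ + ->]]] /=.
  by rewrite mem_rev mem_iota => /andP[].
apply: (sub_in_pairwise (P := fun b => 0 < b.2)); last first.
- exact: subseq_pairwise (filter_subseq _ _) hp.
- by rewrite all_filter; apply: sub_all hc => b /= ->; rewrite implybT.
- move=> [a b] [c d] hb hd; move: (hb : 0 < b) (hd : 0 < d); rewrite /wlt /relpre /=; lia.
Qed.

Lemma mem_biword la F a b : ((a, b) \in biword la F) =
  [&& a <= b, (a, b - a + 1) \in boxes la & (a, b - a + 1) \notin F].
Proof.
apply/mapP/and3P => [[[r c]]|[h1 h2 h3]].
  rewrite mem_filter => /andP[/= hF /allpairsPdep[x [y [hx hy [e1 e2]]]]] [-> ->].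
  subst x y; move: hy; rewrite mem_rev => hy.
  have hrc : (r, c) \in boxes la by apply/allpairsPdep; exists r, c.
  have hc : 0 < c by move: hy; rewrite mem_iota => /andP[].
  by rewrite (_ : r + c - 1 - r + 1 = c); [split=> //; lia|lia].
exists (a, b - a + 1) => /=; last by congr pair; lia.
rewrite mem_filter h3 /=; move: h2 => /allpairsPdep[x [y [hx hy [e1 e2]]]].
by apply/allpairsPdep; exists x, y; rewrite mem_rev -e1 -e2 in hy *; subst x; split.
Qed.

Lemma biword_elbow la F b : b \in boxes la -> (b \in F) = elbow (biword la F) b.
Proof.
case: b => r c h; have := h; rewrite mem_boxes /= => /and3P[h1 h2 _].
rewrite /elbow /= mem_biword (_ : r + c - 1 - r + 1 = c); last by lia.
by rewrite h /= (_ : r <= r + c - 1) ?negbK //; lia.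
Qed.

Lemma biword_pos la F : all (fun x => 0 < x.1 <= x.2) (biword la F).
Proof.
apply/allP => -[a b]; rewrite mem_biword mem_boxes /= => /and3P[-> /and3P[-> _ _] _].
by [].
Qed.

Lemma biword_pos0 w : all (fun x : nat * nat => 0 < x.1 <= x.2) w -> 0 \notin map snd w.
Proof. by move=> h; apply/mapP => -[[a b] /(allP h) /= hab e]; move: hab; lia. Qed.

Lemma perm_rev_rows la :
  perm_eq [seq (r, c) | r <- iota 1 (size la), c <- rev (iota 1 (nth 0 la r.-1))]
    (boxes la).
Proof.
apply: uniq_perm; last 1 first.
- move=> b; apply/allpairsPdep/allpairsPdep => -[x [y [h1 h2 h3]]].
    by exists x, y; split=> //; move: h2; rewrite mem_rev.
  by exists x, y; split=> //; rewrite mem_rev.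
- apply: allpairs_uniq_dep; first exact: iota_uniq.
    by move=> x _; rewrite rev_uniq iota_uniq.
  by move=> [x y] [x' y'] _ _ /= [-> ->].
- exact: boxes_uniq.
Qed.

Lemma card_fset_boxes la (F : {fset nat * nat}) : {subset F <= boxes la} ->
  #|` F| = count (mem F) (boxes la).
Proof.
move=> h; rewrite -size_filter; apply: perm_size; apply: uniq_perm => [||b].
- exact: fset_uniq.
- by rewrite filter_uniq // boxes_uniq.
- by rewrite mem_filter; case hb : (b \in F) => //=; rewrite ?(h _ hb) // hb.
Qed.

Lemma biword_size la (F : {fset nat * nat}) : {subset F <= boxes la} ->
  size (biword la F) + #|` F| = size (boxes la).
Proof.
move=> h; rewrite (card_fset_boxes h) /biword size_map size_filter.
rewrite (permP (perm_rev_rows la)) addnC; exact: count_predC.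
Qed.

Lemma tight_exists v : 0 \notin v -> exists v', [/\ 0 \notin v', hecke_eq v' v & tight v'].
Proof.
have [n] := ubnP (size v); elim: n v => // n IH v hn v0.
have [ht|hnt] := EM (tight v); first by exists v.
have [v' [h1 h2 h3]] : exists v', [/\ 0 \notin v', hecke_eq v' v & size v' < size v].
  apply: contrapT => hno; apply: hnt; split=> // v' h1 h2.
  by rewrite leqNgt; apply/negP => h3; apply: hno; exists v'.
have [|v'' [g1 g2 g3]] := IH v' _ h1; first by lia.
by exists v''; split=> //; apply: hecke_eq_trans h2.
Qed.

Definition tab_boxes (P : tableau) : seq (nat * nat) :=
  [seq (i, j) | j <- iota 1 (size P), i <- iota 1 (size (nth [::] P j.-1))].

Lemma mem_tab_boxes P b : (b \in tab_boxes P) = in_tableau P b.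
Proof.
case: b => i j; rewrite /in_tableau /=.
apply/allpairsPdep/and3P => [[y [x [hy hx [-> ->]]]]|[h1 h2 h3]].
  by move: hy hx; rewrite !mem_iota; split; lia.
exists j, i; rewrite !mem_iota; split=> //; last by lia.
case: (leqP j (size P)) => h; first by lia.
by move: h3; rewrite nth_default /=; lia.
Qed.

Lemma size_tab_boxes P : size (tab_boxes P) = size (reading_word P).
Proof.
rewrite size_allpairs_dep.
have -> : [seq size (iota 1 (size (nth [::] P j.-1))) | j <- iota 1 (size P)] =
    [seq size c | c <- P].
  rewrite -{3}[P](mkseq_nth [::]) /mkseq -map_comp (iotaDl 1 0) -map_comp.
  by apply: eq_map => j /=; rewrite size_iota.
by elim: P => //= c P IH; rewrite size_cat -IH addnC.
Qed.

(** * North-east fillings *)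

Section NorthEast.
Variables (la : seq nat) (k : nat).
Hypothesis hla : is_ferrers la.

Let mu := inner k la.

Lemma rank_bounded_hecke_eq u v : hecke_eq u v -> rank_bounded la k v -> rank_bounded la k u.
Proof. by move=> e h p q hpq; rewrite e; apply: h. Qed.

Lemma rank_bounded_mu v : rank_bounded la k v -> forall i j, (i, j) \in boxes mu ->
  cnt (bubbles v (upto (i + k))) (j + k) <= k.
Proof. by move=> h i j; rewrite mem_inner // => /and3P[_ _]; apply: h. Qed.

Lemma boxes_pos l (i j : nat) : (i, j) \in boxes l -> 0 < i /\ 0 < j.
Proof. by rewrite mem_boxes => /and3P[]. Qed.

Lemma boxes_sub_tab P : valid P -> 0 \notin reading_word P -> rank_bounded la k (reading_word P) ->
  {subset boxes mu <= tab_boxes P}.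
Proof.
move=> hv h0 hr [i j] hij; rewrite mem_tab_boxes /in_tableau /=.
have [-> -> /=] := boxes_pos hij.
by have [] := rank_shape (mu := mem (boxes mu)) hv h0 (@boxes_pos _) (rank_bounded_mu hr) hij.
Qed.

(** Passing to a shortest word with the same action does not lengthen v, and the insertion tableau
    of that word contains mu. Only this tableau is used, so the recorded letters are all set to
    0. *)
Lemma rank_size v : 0 \notin v -> rank_bounded la k v -> size (boxes mu) <= size v.
Proof.
move=> v0 hr; have [v' [v'0 e ht]] := tight_exists v0.
have [|s [P h]] := @run_exists [seq (0, b) | b <- v'].
  by rewrite -map_comp map_id.
have [e' sz] := run_hecke_eq h; have hp := run_pos h.
rewrite -map_comp map_id in e' hp; rewrite size_map in sz.
have [_ hmin] := ht; apply: leq_trans (_ : size v' <= _); last first.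
  exact: hmin v0 (hecke_eq_sym e).
rewrite sz -size_tab_boxes; apply: uniq_leq_size; first exact: boxes_uniq.
apply: boxes_sub_tab; rewrite -?hp //; first exact: run_valid h.
by apply: rank_bounded_hecke_eq hr; apply: hecke_eq_trans (hecke_eq_sym e') e.
Qed.

Lemma rank_tight v : 0 \notin v -> rank_bounded la k v ->
  size v <= size (boxes mu) -> tight v.
Proof.
move=> v0 hr hsz; split=> // v' v'0 e; apply: leq_trans hsz _.
by apply: rank_size => //; apply: rank_bounded_hecke_eq e hr.
Qed.

Definition canonical (P : tableau) := [/\ valid P, has_shape mu P &
  forall u i, i < size (nth [::] P u) -> nth 0 (nth [::] P u) i = k + i.+1 + u].

Lemma rank_canonical P : valid P -> 0 \notin reading_word P -> rank_bounded la k (reading_word P) ->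
  size (reading_word P) <= size (boxes mu) -> canonical P.
Proof.
move=> hv h0 hr hsz; have hsub := boxes_sub_tab hv h0 hr.
rewrite -size_tab_boxes in hsz.
have [_ hmem] := uniq_min_size (boxes_uniq mu) hsub hsz.
have hs : has_shape mu P by move=> b; rewrite -mem_tab_boxes hmem.
split=> //; apply: (rank_unique (mu := mem (boxes mu)) hv h0 (@boxes_pos _)
  (rank_bounded_mu hr)) => i j.
by move=> /andP[h1 h2]; rewrite /= -hs /in_tableau /= h1.
Qed.

Lemma shape_col_size l P Q u : has_shape l P -> has_shape l Q ->
  size (nth [::] P u) = size (nth [::] Q u).
Proof.
have sub P' Q' : has_shape l P' -> has_shape l Q' ->
    size (nth [::] P' u) <= size (nth [::] Q' u).
  move=> hP hQ; case e : (size _) => [//|n].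
  have : in_tableau P' (n.+1, u.+1) by rewrite /in_tableau /= e.
  by rewrite hP -hQ /in_tableau.
by move=> hP hQ; apply/eqP; rewrite eqn_leq !sub.
Qed.

Lemma canonical_inj P Q : canonical P -> canonical Q -> P = Q.
Proof.
have szle P' Q' : canonical P' -> canonical Q' -> size P' <= size Q'.
  case=> hv hP _ [hv' hQ _]; rewrite leqNgt; apply/negP => h.
  have := shape_col_size (size Q') hP hQ; rewrite (nth_default _ (leqnn _)) => /size0nil.
  by apply: (valid_nonempty hv); apply: mem_nth.
move=> hP hQ; have [hvP hP1 hP2] := hP; have [hvQ hQ1 hQ2] := hQ.
have hs u := shape_col_size u hP1 hQ1.
apply: (eq_from_nth (x0 := [::])) => [|u _].
  by apply/eqP; rewrite eqn_leq !szle.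
apply: (eq_from_nth (x0 := 0)) => // i hi.
by rewrite hP2 // hQ2 // -hs.
Qed.

(** The translate of mu by k rows. Its complement in la is an explicit maximal filling: it shows
    that |mu| zeros are possible and supplies an instance of the canonical tableau. *)
Definition bottom : pred (nat * nat) := fun b =>
  (k < b.1) && ((b.1 - k, b.2) \in boxes mu).

Definition bottom_filling : {fset nat * nat} :=
  [fset b in [seq b <- boxes la | ~~ bottom b]]%fset.

Lemma mem_bottom_filling b : (b \in bottom_filling) = ~~ bottom b && (b \in boxes la).
Proof. by rewrite inE /= mem_filter. Qed.

Lemma chain_span (b : nat * nat) c : sorted ne_step (b :: c) ->
  b.2 + size c <= (last b c).2 /\ (last b c).1 + size c <= b.1.
Proof.
elim: c b => [|b' c IH] b /=; first by rewrite !addn0.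
by move=> /andP[/andP[h1 h2]] /IH; lia.
Qed.

(** A chain of length k + 1 starting at b forces k < b.1 and forces the box (b.1, b.2 + k) to lie in
    its rectangle, hence in la. But then b belongs to [bottom]. *)
Lemma bottom_chain_free : chain_free ne_step la k bottom_filling.
Proof.
split; first by move=> b; rewrite mem_bottom_filling => /andP[].
case=> [[|b c] [[c1 c2 c3] //= [hsz] hF]].
have := hF b; rewrite inE eqxx mem_bottom_filling => /(_ isT) /andP[/negP hb hbl].
have [h1 h2] := chain_span c2; rewrite hsz in h1 h2.
have hl := c1 (last b c) (mem_last _ _).
have hpq : (b.1, (last b c).2) \in boxes la.
  apply: c3; apply/and4P; split; apply/hasP.
  - by exists b => //; rewrite inE eqxx.
  - by exists b => //; rewrite inE eqxx.
  - by exists (last b c) => //; apply: mem_last.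
  - by exists (last b c) => //; apply: mem_last.
apply: hb; move: hl hbl; rewrite !mem_boxes => /and3P[h3 h4 h5] /and3P[h6 h7 h8].
have hk : k < b.1 by apply: leq_trans h2; rewrite -(add1n k) leq_add2r; exact: h3.
have hq : b.2 + k <= (last b c).2 := h1.
rewrite /bottom mem_inner // hk subn_gt0 hk h7 subnK ?(ltnW hk) //=.
by apply: (boxes_closed hla hpq) => /=; rewrite ?h6 ?leqnn // hq addn_gt0 h7.
Qed.

Lemma bottom_size : size (biword la bottom_filling) = size (boxes mu).
Proof.
have hsub : {subset bottom_filling <= boxes la}.
  by move=> b; rewrite mem_bottom_filling => /andP[].
have := biword_size hsub; rewrite (card_fset_boxes hsub).
have -> : count (mem bottom_filling) (boxes la) = count (predC bottom) (boxes la).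
  by apply: eq_in_count => b hb; rewrite /= mem_bottom_filling hb andbT.
rewrite -(count_predC bottom (boxes la)) => /addIn ->.
rewrite -size_filter -(size_map (fun b : nat * nat => (b.1 + k, b.2)) (boxes mu)).
apply: perm_size; apply: uniq_perm.
- by rewrite filter_uniq // boxes_uniq.
- rewrite map_inj_uniq ?boxes_uniq // => -[i j] [i' j'] /= [] /addIn -> ->.
  by [].
move=> [i j]; rewrite mem_filter /bottom /=; apply/andP/mapP => [[/andP[h1 h2] h3]|].
  by exists (i - k, j) => //=; rewrite subnK // ltnW.
case=> -[i' j'] h [-> ->] /=; rewrite addnK h; have := h; rewrite mem_inner //.
move=> /and3P[h1 h2 h3]; split; first by lia.
by apply: (boxes_closed hla h3) => /=; lia.
Qed.

Lemma filling_rank F : chain_free ne_step la k F -> rank_bounded la k (map snd (biword la F)).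
Proof.
move=> h; have [hF _] := h; move: h.
have := chain_free_rank k hla (biword_sorted la F) (biword_pos la F) hF.
by case=> [b hb|h _]; [exact: biword_elbow|exact: h].
Qed.

Lemma filling_size F : F_NE la k F -> size (biword la F) = size (boxes mu).
Proof.
case=> hF hmax; have [hsub _] := hF.
have hle : size (boxes mu) <= size (biword la F).
  rewrite -(size_map snd (biword la F)); apply: rank_size; last exact: filling_rank.
  exact/biword_pos0/biword_pos.
have := hmax _ bottom_chain_free; have := biword_size hsub.
have hsub0 := (bottom_chain_free).1; have := biword_size hsub0.
by rewrite bottom_size; lia.
Qed.

Lemma filling_max F : chain_free ne_step la k F ->
  size (biword la F) <= size (boxes mu) -> F_NE la k F.
Proof.
move=> hF hsz; split=> // G hG.
have : size (boxes mu) <= size (biword la G).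
  rewrite -(size_map snd (biword la G)); apply: rank_size; last exact: filling_rank.
  exact/biword_pos0/biword_pos.
have := biword_size hF.1; have := biword_size hG.1; lia.
Qed.

Lemma filling_run F : F_NE la k F -> exists s P, run (biword la F) s P /\ canonical P.
Proof.
move=> hF; have hsz := filling_size hF; have hr := filling_rank hF.1.
have h0 := biword_pos0 (biword_pos la F).
have [|s [P h]] := @run_exists (biword la F).
  by apply: rank_tight => //; rewrite size_map hsz.
exists s, P; split=> //; have [e sz] := run_hecke_eq h; apply: rank_canonical.
- exact: run_valid h.
- by rewrite -(run_pos h).
- exact: rank_bounded_hecke_eq (hecke_eq_sym e) hr.
- by rewrite -sz hsz.
Qed.

Lemma bottom_F_NE : F_NE la k bottom_filling.
Proof. by apply: filling_max; [exact: bottom_chain_free|rewrite bottom_size]. Qed.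

Lemma Qtab_run F s P : run (biword la F) s P -> Qtab la F = Qof s.
Proof. by move=> h; rewrite /Qtab /recording_tableau (run_foldl h). Qed.

Lemma entry_Qof s i j : entry (Qof s) i j = nth 0 (col j.-1 s) i.-1.
Proof. by rewrite /entry nth_Qof. Qed.

Lemma mu_col F s P i j : run (biword la F) s P -> canonical P ->
  ((i, j) \in boxes mu) = [&& 0 < i, 0 < j & i <= size (col j.-1 s)].
Proof. by move=> h [_ hP _]; rewrite -hP /in_tableau /= (run_shape _ h). Qed.

Lemma col_sorted u s : sorted lexlt s -> sorted ltn (col u s).
Proof.
move=> h; rewrite sorted_map.
have := sorted_filter lexlt_trans (fun p => p.2 == u) h.
apply: (sub_in_sorted (P := fun p => p.2 == u)) => [[a b] [c d]|].
  rewrite unfold_in => /= /eqP -> ; rewrite unfold_in => /= /eqP ->.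
  by rewrite /lexlt /relpre /= ltnn andbF orbF.
by apply/allP => p; rewrite mem_filter => /andP[].
Qed.

Lemma sorted_ltn_ge c i : sorted ltn c -> {in c, forall x, 0 < x} -> i < size c ->
  i < nth 0 c i.
Proof.
move=> hs hc; elim: i => [|i IH] hi; first by apply: hc; apply: mem_nth.
by apply: leq_ltn_trans (IH (ltnW hi)) (sorted_nth_lt hs (ltnSn i) hi).
Qed.

Lemma filling_tableau F : F_NE la k F ->
  [/\ has_shape mu (Qtab la F), k_flagged k mu (Qtab la F) &
      R_well_defined k mu (Qtab la F) (Rtab la F)].
Proof.
move=> hF; have [s [P [hr hP]]] := filling_run hF.
have [hv hsh hent] := hP; rewrite /Rtab (Qtab_run hr).
have [hs hrow] := run_ssyt hr (biword_sorted la F).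
have hlow i j : (i, j) \in boxes mu -> i <= entry (Qof s) i j <= i + k.
  rewrite (mu_col _ _ hr hP) entry_Qof; case: i => // i; case: j => // j /= hi.
  apply/andP; split.
    apply: sorted_ltn_ge => //; first exact: col_sorted.
    move=> x; rewrite mem_col => hx.
    have : x \in map fst (biword la F) by rewrite (run_fst hr); apply/mapP; exists (x, j).
    by case/mapP=> b /(allP (biword_pos la F)) /andP[h _] ->.
  (* The summand u of this bound cancels against the value k + i + 1 + u of the canonical entry,
     which leaves exactly the flag. *)
  have := @run_flag_fwd _ _ _ hr (biword_sorted la F) _ j i hi.
  rewrite hent; last by rewrite (run_shape j hr).
  suff ha : all (fun p : nat * nat => p.1 <= p.2) (biword la F) by move=> /(_ ha); lia.
  by apply: sub_all (biword_pos la F) => b /andP[].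
have hR i j : (i, j) \in boxes mu -> (i, j.+1) \in boxes mu ->
    entry (Qof s) i j <= entry (Qof s) i j.+1.
  rewrite !(mu_col _ _ hr hP) !entry_Qof; case: i => // i; case: j => // j /= _ hi.
  by have [] := hrow j i hi.
have hC i j : (i, j) \in boxes mu -> (i.+1, j) \in boxes mu ->
    entry (Qof s) i j < entry (Qof s) i.+1 j.
  rewrite !(mu_col _ _ hr hP) !entry_Qof; case: i => // i; case: j => // j /= _ hi.
  by apply: sorted_nth_lt => //; apply: col_sorted.
split.
- move=> b; rewrite -hsh /in_tableau nth_Qof (run_shape _ hr) //.
- split=> // i j hij; have := hlow i j hij; have [hi _] := boxes_pos hij; lia.
- split=> i j hij; first by have := hlow i j hij; lia.
    by move=> h; have := hR i j hij h; lia.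
  by move=> h; have := hC i j hij h; have := hlow i j hij; lia.
Qed.

Lemma filling_eq F G : {subset F <= boxes la} -> {subset G <= boxes la} ->
  biword la F = biword la G -> F = G.
Proof.
move=> hF hG e; apply/fsetP => b; case hb : (b \in boxes la).
  by rewrite !(@biword_elbow la _ b hb) e.
by apply/idP/idP => [/hF|/hG]; rewrite hb.
Qed.

Lemma filling_inj F G : F_NE la k F -> F_NE la k G ->
  (forall i j, (i, j) \in boxes mu -> Rtab la F i j = Rtab la G i j) -> F = G.
Proof.
move=> hF hG e; have [s [P [hr hP]]] := filling_run hF.
have [t [P' [hr' hP']]] := filling_run hG.
have eP := canonical_inj hP hP'; subst P'.
apply: filling_eq; [exact: hF.1.1|exact: hG.1.1|].
suff est : s = t by subst t; exact: run_inj hr hr'.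
apply: ssyt_inj.
- exact: run_lexlt hr (biword_sorted _ _).
- exact: run_lexlt hr' (biword_sorted _ _).
move=> u; apply: (eq_from_nth (x0 := 0)); first by rewrite -(run_shape u hr) (run_shape u hr').
move=> i hi; have hij : (i.+1, u.+1) \in boxes mu by rewrite (mu_col _ _ hr hP).
have [_ _ [h1 _ _]] := filling_tableau hF; have [_ _ [h2 _ _]] := filling_tableau hG.
have [{}h1 _] := h1 _ _ hij; have [{}h2 _] := h2 _ _ hij.
have := e _ _ hij; rewrite /Rtab; move: h1 h2.
by rewrite (Qtab_run hr) (Qtab_run hr') !entry_Qof /=; lia.
Qed.

Lemma filling_surj (R : nat -> nat -> nat) :
  (forall i j, (i, j) \in boxes mu -> R i j <= k) ->
  (forall i j, (i, j) \in boxes mu -> (i, j.+1) \in boxes mu -> R i j <= R i j.+1) ->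
  (forall i j, (i, j) \in boxes mu -> (i.+1, j) \in boxes mu -> R i j <= R i.+1 j) ->
  exists2 F, F_NE la k F &
    forall i j, (i, j) \in boxes mu -> Rtab la F i j = R i j.
Proof.
move=> hRk hRr hRc.
have [s0 [P [hr0 hP]]] := filling_run bottom_F_NE.
have [hv hsh hent] := hP.
have hmu i j : ((i.+1, j.+1) \in boxes mu) = (i < size (nth [::] P j)).
  by rewrite -hsh /in_tableau.
have htP : tight (reading_word P).
  apply: (run_tight hr0).1; apply: rank_tight.
  - exact/biword_pos0/biword_pos.
  - exact/filling_rank/bottom_chain_free.
  - by rewrite size_map bottom_size.
pose good (p : nat * nat) := has (fun b => p == (R b.1 b.2 + b.1, b.2.-1)) (boxes mu).
(* The tableau with entries R + i, listed in recording order by filtering a lexicographically sorted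
   rectangle. Entries are at most k + size mu, and columns are numbered from 0. *)
pose s := [seq p <- [seq (a, u) | a <- iota 0 (size mu + k + 1), u <- iota 0 (size P)] | good p].
have hs : sorted lexlt s.
  rewrite (sorted_pairwise lexlt_trans).
  apply: subseq_pairwise (filter_subseq _ _) _.
  apply: (@allpairs_sorted _ ltn ltn) => [|_];
    by rewrite -(sorted_pairwise ltn_trans) iota_ltn_sorted.
have hcol u : col u s = [seq R i u.+1 + i | i <- iota 1 (size (nth [::] P u))].
  apply: (irr_sorted_eq ltn_trans ltnn).
  - exact: col_sorted.
  - rewrite sorted_map; apply/(sortedP 0) => i; rewrite size_iota => hi.
    rewrite !nth_iota //; last by apply: ltnW.
    rewrite /relpre /= !add1n; suff : R i.+1 u.+1 <= R i.+2 u.+1 by lia.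
    by apply: hRc; rewrite hmu //; apply: ltnW.
  move=> x; rewrite mem_col mem_filter; apply/andP/mapP.
    case=> /hasP[[i j]] h /eqP[-> ->] _; have [h1 h2] := boxes_pos h.
    case: i j h h1 h2 => // i [//|j] h _ _; exists i.+1 => //.
    by rewrite mem_iota /= add1n ltnS -hmu.
  case=> [[|i]]; rewrite mem_iota //= add1n ltnS -hmu => h ->; split.
    by apply/hasP; exists (i.+1, u.+1).
  apply/allpairsPdep; exists (R i.+1 u.+1 + i.+1), u; rewrite !mem_iota; split=> //.
    have := hRk _ _ h; move: h; rewrite mem_boxes /= => h.
    have : i < size mu by case: (ltnP i (size mu)) h => // h'; rewrite nth_default.
    lia.
  by move: h; rewrite hmu; case: (ltnP u (size P)) => // h'; rewrite nth_default.
have hssyt : ssyt s.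
  split=> // u i; rewrite !hcol !size_map !size_iota => hi.
  have [h1 _] := valid_colle u hv; have hi' := leq_trans hi h1; split=> //.
  rewrite !(nth_map 0) ?size_iota // !nth_iota // add1n leq_add2r.
  by apply: hRr; rewrite hmu.
have [u|w [hr hw]] := run_surj hssyt hv htP.
  by rewrite hcol size_map size_iota.
have hpos : all (fun x => 0 < x.1 <= x.2) w.
  have hflag : all (fun p => p.1 <= p.2) w.
    (* With rows numbered from 0, k + 1 + i is both the flag of row i and the canonical entry of its
       first column. *)
    apply: (@run_flag_bwd k.+1 _ _ _ hr).
      by move=> i hi; rewrite -nth0 hent ?nth0 // addn0 addSnnS.
    move=> u i; rewrite hcol size_map size_iota => hi.
    rewrite (nth_map 0) ?size_iota // nth_iota // add1n.
    by have := hRk i.+1 u.+1; rewrite hmu => /(_ hi); lia.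
  apply/allP => -[a b] hab; rewrite (allP hflag _ hab) andbT /=.
  have : a \in map fst s by rewrite -(run_fst hr); apply/mapP; exists (a, b).
  case/mapP=> -[c d]; rewrite mem_filter => /andP[/hasP[[i j] h /eqP[-> _]] _] -> /=.
  by have [h1 _] := boxes_pos h; lia.
have [ew szw] := run_hecke_eq hr.
have hrw : rank_bounded la k (map snd w).
  apply: (rank_bounded_hecke_eq ew); apply: rank_bounded_hecke_eq (hecke_eq_sym (run_hecke_eq hr0).1) _.
  exact/filling_rank/bottom_chain_free.
have hszw : size w = size (boxes mu).
  by rewrite szw -(run_hecke_eq hr0).2 bottom_size.
pose F := [fset b in [seq b <- boxes la | elbow w b]]%fset.
have hF b : (b \in F) = elbow w b && (b \in boxes la) by rewrite inE /= mem_filter.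
have hfree : chain_free ne_step la k F.
  apply: (chain_free_rank k hla hw hpos _ _).2 => //.
    by move=> b; rewrite hF => /andP[].
  by move=> b hb; rewrite hF hb andbT.
(* A priori w may have crosses outside la, which [biword la F] forgets. But F is chain-free, so its
   biword has at least |mu| letters by [rank_size], as many as w. *)
have ebw : biword la F = w.
  have hsub : {subset biword la F <= w}.
    move=> [a b]; rewrite mem_biword hF => /and3P[h1 h2].
    rewrite h2 andbT negbK /= (_ : a + (b - a + 1) - 1 = b) //; lia.
  have hun : uniq (biword la F) by apply: (sorted_uniq wlt_trans wlt_irr); apply: biword_sorted.
  apply: (irr_sorted_eq wlt_trans wlt_irr (biword_sorted la F) hw).
  apply: (uniq_min_size hun hsub _).2; rewrite hszw -(size_map snd (biword la F)).
  by apply: rank_size (filling_rank hfree); apply/biword_pos0/biword_pos.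
exists F; first by apply: filling_max => //; rewrite ebw hszw.
move=> [|i] [|j] h; try by have [] := boxes_pos h.
rewrite -ebw in hr; rewrite /Rtab (Qtab_run hr) entry_Qof /= hcol.
rewrite hmu in h; rewrite (nth_map 0) ?size_iota // nth_iota // add1n.
by rewrite addnK.
Qed.

End NorthEast.

(** * Separating paths *)

Lemma count_initial (P : pred nat) m i :
  (forall i, 0 < i -> P i.+1 -> P i) -> 0 < i <= m ->
  (i <= count P (iota 1 m)) = P i.
Proof.
move=> hP; have hdown j l : 0 < j -> j <= l -> P l -> P j.
  move=> hj /subnK <-; elim: (l - j) => // d IH h; apply/IH/hP => //; lia.
elim: m i => [|m IH] i; first by lia.
move=> /andP[hi]; rewrite -(addn1 m) iotaD count_cat /= addn0 add1n addn1.
have hc : count P (iota 1 m) <= m by rewrite -{2}(size_iota 1 m) count_size.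
rewrite leq_eqVlt => /orP[/eqP ->|hm].
  case hPm : (P m.+1); last by lia.
  case: m IH hc hPm => // m IH hc hPm; have := IH m.+1.
  by rewrite (hdown m.+1 m.+2) // ltnSn /= => /(_ isT); lia.
have := IH i; rewrite hi -ltnS hm /= => /(_ isT) <-.
by case hPm : (P m.+1); rewrite ?addn0 // addn1;
   have := IH i; rewrite hi -ltnS hm (hdown i m.+1) //; [lia|exact: ltnW].
Qed.

Section Paths.
Variables (la : seq nat) (k : nat).
Hypothesis hla : is_ferrers la.

Let mu := inner k la.
Let m := size mu.
Let n := head 0 mu.

(** Reverse plane partitions of shape mu with entries at most k. *)
Definition plane (R : nat -> nat -> nat) := [/\
  forall i j, (i, j) \in boxes mu -> R i j <= k,
  forall i j, (i, j) \in boxes mu -> (i, j.+1) \in boxes mu -> R i j <= R i j.+1 &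
  forall i j, (i, j) \in boxes mu -> (i.+1, j) \in boxes mu -> R i j <= R i.+1 j].

Lemma mu_ferrers : is_ferrers mu.
Proof. exact: inner_ferrers. Qed.

Lemma mu_closed (i j i' j' : nat) : (i, j) \in boxes mu -> 0 < i' <= i -> 0 < j' <= j ->
  (i', j') \in boxes mu.
Proof. by move=> h h1 h2; apply: (boxes_closed mu_ferrers h). Qed.

Lemma mu_bounds (i j : nat) : (i, j) \in boxes mu -> [/\ 0 < i, 0 < j, i <= m & j <= n].
Proof.
move=> h; have [h1 h2] := boxes_pos h; split=> //.
  move: h; rewrite mem_boxes /= => /and3P[_ _]; case: (leqP i m) => // him.
  by rewrite nth_default -?/m; lia.
have := @mu_closed i j 1 j h; rewrite h1 h2 leqnn /= leqnn => /(_ isT isT).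
by rewrite mem_boxes /= nth0 h2.
Qed.

Lemma mu_top j : 0 < j <= n -> (1, j) \in boxes mu.
Proof. by rewrite mem_boxes /= nth0. Qed.

Lemma mu_left i : 0 < i <= m -> (i, 1) \in boxes mu.
Proof.
move=> /andP[hi him]; rewrite mem_boxes /= hi /=.
have : nth 0 mu i.-1 \in mu by apply: mem_nth; rewrite -/m; lia.
by move=> /mapP[x]; rewrite mem_filter => /andP[hx _] ->; rewrite subn_gt0.
Qed.

Variable R : nat -> nat -> nat.
Hypothesis hR : plane R.

Lemma plane_mono (i j i' j' : nat) : (i, j) \in boxes mu -> 0 < i' <= i -> 0 < j' <= j ->
  R i' j' <= R i j.
Proof.
move=> h hi hj; have [_ h1 h2] := hR.
apply: (@leq_trans (R i j')).
  have : (i, j') \in boxes mu by apply: (mu_closed h); lia.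
  move: hi => /andP[hi0 /subnK <-]; elim: (i - i') => // d IH hd.
  have hd' : (d + i', j') \in boxes mu by apply: (mu_closed hd); lia.
  by apply: leq_trans (IH hd') _; apply: h2.
have [hi0 _] := boxes_pos h.
move: hj h => /andP[hj0 /subnK <-]; elim: (j - j') => // d IH hd.
have hd' : (i, d + j') \in boxes mu by apply: (mu_closed hd); lia.
by apply: leq_trans (IH hd') _; apply: h1.
Qed.

(* after t steps the path P_s is on the diagonal t - m; [inside s i t] says that
   the box of row i on this diagonal is in the region R < s, where boxes left of
   the first column count as inside *)
Definition inside (s i t : nat) : bool :=
  (i + t <= m) || (((i, i + t - m) \in boxes mu) && (R i (i + t - m) < s)).

(** The first coordinate of the path P_s after t steps. By [inside_NW] the predicate [inside] holds
    on an initial segment of the rows, so a count finds its end. *)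
Definition height (s t : nat) : nat := count (fun i => inside s i t) (iota 1 m).

Lemma inside_NW s i i' t t' : 0 < i' <= i -> i' + t' <= i + t -> inside s i t ->
  inside s i' t'.
Proof.
move=> hi ht; rewrite /inside => h; case: (leqP (i' + t') m) => //= hm.
move: h; rewrite leqNgt (leq_trans hm ht) /= => /andP[h1 h2].
have hi' : (i', i' + t' - m) \in boxes mu by apply: (mu_closed h1); lia.
rewrite hi' /=; apply: leq_ltn_trans h2; apply: plane_mono => //; lia.
Qed.

Lemma height_inside s i t : 0 < i <= m -> (i <= height s t) = inside s i t.
Proof.
apply: count_initial => l hl; apply: inside_NW; lia.
Qed.

Lemma height_le s t : height s t <= m.
Proof. by rewrite -[X in _ <= X](size_iota 1 m) count_size. Qed.

Lemma height_S s t : height s t.+1 <= height s t /\ height s t <= (height s t.+1).+1.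
Proof.
split.
  case e : (height s t.+1) => [//|x].
  have hx : 0 < x.+1 <= m by rewrite /= -e height_le.
  rewrite height_inside //; have : x.+1 <= height s t.+1 by rewrite e.
  rewrite height_inside //; apply: inside_NW => //; lia.
case e : (height s t) => [//|[//|x]]; rewrite ltnS.
have hx : 0 < x.+2 <= m by rewrite /= -e height_le.
rewrite height_inside; last by lia.
have : x.+2 <= height s t by rewrite e.
by rewrite height_inside //; apply: inside_NW; lia.
Qed.

Lemma height_0 s : height s 0 = m.
Proof.
apply/eqP; rewrite eqn_leq height_le /=; case: (posnP m) => [-> //|h].
by rewrite height_inside ?h ?leqnn // /inside addn0 leqnn.
Qed.

Lemma height_end s : height s (m + n) = 0.
Proof.
case e : (height s (m + n)) => [//|x].
have hx : 0 < x.+1 <= m by rewrite /= -e height_le.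
have : x.+1 <= height s (m + n) by rewrite e.
rewrite height_inside // /inside; case/orP; first by lia.
by move=> /andP[/mu_bounds[_ _ _]]; lia.
Qed.

Lemma height_ge s t : m <= height s t + t.
Proof.
case: (leqP m t) => h; first by lia.
suff : m - t <= height s t by lia.
by rewrite height_inside /inside; lia.
Qed.

Definition pt (w : seq bool) (t : nat) : nat * nat := foldl move (m, 0) (take t w).

Lemma path_pointsE w : path_points mu w = mkseq (pt w) (size w).+1.
Proof.
apply: (eq_from_nth (x0 := (0, 0))); first by rewrite size_mkseq /= size_scanl.
case=> [|t] ht; rewrite nth_mkseq //; first by rewrite /pt take0.
  by rewrite /= nth_scanl //; move: ht; rewrite /= size_scanl.
by move: ht; rewrite /= size_scanl.
Qed.

Lemma ptE w t : pt w t = (m - count negb (take t w), count id (take t w)).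
Proof.
rewrite /pt; elim/last_ind: (take t w) => [|v e IH]; first by rewrite subn0.
rewrite foldl_rcons IH -cats1 !count_cat /= !addn0 /move; case: e => /=.
  by rewrite addn0 addn1.
by rewrite addn0 addn1 subnS.
Qed.

Lemma count_id_negb (v : seq bool) : count id v + count negb v = size v.
Proof. exact: count_predC. Qed.

Lemma path_last (w : (m + n).-tuple bool) :
  last (m, 0) (path_points mu w) = pt w (m + n).
Proof.
by rewrite path_pointsE size_tuple /mkseq -addn1 iotaD map_cat cats1 last_rcons.
Qed.

Lemma count_take_le (a : pred bool) t (w : seq bool) : count a (take t w) <= count a w.
Proof. by rewrite -{2}(cat_take_drop t w) count_cat leq_addr. Qed.

Section OnePath.
Hypothesis hmu : 0 < m.
Variable w : (m + n).-tuple bool.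
Hypothesis hlast : last (m, 0) (path_points mu w) == (0, n).

Lemma north_count : count negb w = m.
Proof.
move: hlast; rewrite path_last ptE take_oversize ?size_tuple // => /eqP[_ h].
by have := count_id_negb w; rewrite h size_tuple; lia.
Qed.

Lemma pt_diag t : t <= m + n -> (pt w t).2 + m = (pt w t).1 + t.
Proof.
move=> h; rewrite ptE /=; have := count_id_negb (take t w).
rewrite size_takel ?size_tuple // => e.
by have := count_take_le negb t w; rewrite north_count; lia.
Qed.

Lemma pt_mono t t' : t <= t' -> (pt w t').1 <= (pt w t).1 /\ (pt w t).2 <= (pt w t').2.
Proof.
move=> h; rewrite !ptE /=; have e : take t w = take t (take t' w) by rewrite take_takel.
have := count_take_le negb t (take t' w); have := count_take_le id t (take t' w).
by rewrite -e; lia.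
Qed.

(** Only the point of the path on the diagonal of the box matters: earlier points are no further
    east and later ones no further south. *)
Lemma pt_nw (i j : nat) : (i, j) \in boxes mu ->
  nw_of_path (i, j) (path_points mu w) = (i <= (pt w (j + m - i)).1).
Proof.
move=> hij; have [hi hj him hjn] := mu_bounds hij.
have ht0 : j + m - i <= m + n by lia.
have hd := pt_diag ht0.
rewrite path_pointsE /nw_of_path; apply/hasP/idP => [[p /mapP[t]]|h].
  rewrite mem_iota size_tuple => ht -> /= /andP[h1 h2].
  case: (leqP t (j + m - i)) => htt; have := pt_mono htt; first by lia.
  by have := pt_mono (ltnW htt); lia.
exists (pt w (j + m - i)); last by rewrite h /=; lia.
by apply: map_f; rewrite mem_iota size_tuple; lia.
Qed.

(** Through [pt_nw] the separation condition splits into one condition per diagonal, which fixes the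
    row of the point there. Uniqueness is then immediate, and existence amounts to following the
    heights. *)
Lemma separating_height s : separating_path mu R s w <->
  forall t, t <= m + n -> (pt w t).1 = height s t.
Proof.
split=> [/and3P[_ /allP hcl /allP hsep] t ht|h].
  have hd := pt_diag ht.
  have key i : 0 < i <= m -> (i <= (pt w t).1) = inside s i t.
    move=> /andP[hi him]; apply/idP/idP => [hx|].
      rewrite /inside; case: (leqP (i + t) m) => //= hm.
      have hin : pt w t \in path_points mu w.
        by rewrite path_pointsE map_f // mem_iota size_tuple; lia.
      have /hasP[[a b] hab /= hcl'] := hcl _ hin.
      have hbox : (i, i + t - m) \in boxes mu by apply: (mu_closed hab); lia.
      rewrite hbox /=; have /eqP <- := hsep _ hbox.
      by rewrite pt_nw // (_ : i + t - m + m - i = t) //; lia.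
    case/orP => [hit|/andP[hbox hRs]].
      by rewrite ptE /=; have := count_size negb (take t w); rewrite size_take; case: ifP; lia.
    have := hsep _ hbox; rewrite hRs eqb_id pt_nw // (_ : i + t - m + m - i = t) //.
    by have [] := mu_bounds hbox; lia.
  have hle : (pt w t).1 <= m by rewrite ptE leq_subr.
  apply/eqP; rewrite eqn_leq; apply/andP; split.
    case: (posnP (pt w t).1) => [-> //|h0].
    by rewrite height_inside ?h0 // -key ?leqnn // h0.
  case: (posnP (height s t)) => [-> //|h0].
  by rewrite key ?h0 ?height_le // -height_inside ?leqnn // h0 height_le.
apply/and3P; split=> //.
  apply/allP => p; rewrite path_pointsE => /mapP[t]; rewrite mem_iota size_tuple => ht ->.
  have ht' : t <= m + n by lia.
  have hd := pt_diag ht'; have hx := h _ ht'.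
  have hx2 : (pt w t).2 = height s t + t - m by lia.
  have hge := height_ge s t; have hle := height_le s t.
  rewrite /in_closure; case: (posnP (pt w t).1) => h1.
    case: (posnP (pt w t).2) => h2.
      apply/hasP; exists (1, 1); first by apply: mu_left; lia.
      by rewrite h1 h2.
    apply/hasP; exists (1, (pt w t).2); last by rewrite h1 /=; lia.
    by apply: mu_top; lia.
  case: (posnP (pt w t).2) => h2.
    apply/hasP; exists ((pt w t).1, 1); last by rewrite h2 /=; lia.
    by apply: mu_left; lia.
  apply/hasP; exists (pt w t); last by lia.
  have : height s t <= height s t by [].
  rewrite height_inside; last by lia.
  rewrite /inside (_ : _ <= m = false) /=; last by lia.
  rewrite -hx (_ : (pt w t).1 + t - m = (pt w t).2); last by lia.
  by rewrite -surjective_pairing => /andP[].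
apply/allP => -[i j] hij; have [hi hj him hjn] := mu_bounds hij.
rewrite pt_nw // h; last by lia.
rewrite height_inside ?hi // /inside (_ : i + (j + m - i) - m = j); last by lia.
by rewrite hij /= (_ : _ <= m = false) //; lia.
Qed.

End OnePath.

End Paths.

Section PathExistence.
Variables (la : seq nat) (k : nat).
Hypothesis hla : is_ferrers la.

Let mu := inner k la.
Let m := size mu.
Let n := head 0 mu.

Variable R : nat -> nat -> nat.
Hypothesis hR : plane la k R.
Hypothesis hmu : 0 < m.

Let height := height la k R.

Definition path_word s : (m + n).-tuple bool :=
  [tuple of mkseq (fun t => height s t.+1 == height s t) (m + n)].

Lemma path_word_pt s t : t <= m + n ->
  pt la k (path_word s) t = (height s t, height s t + t - m).
Proof.
elim: t => [|t IH] ht.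
  by rewrite /pt take0 /= /height (height_0 hla hR) addn0 subnn.
have ht' := ltnW ht.
rewrite /pt (take_nth false) ?size_tuple // foldl_rcons -/(pt la k _ t) IH //.
rewrite nth_mkseq // /move /=.
have [h1 h2] := height_S hla hR s t; have h3 := height_ge hla hR s t.
have h4 := height_ge hla hR s t.+1.
rewrite -/height -/mu -/m in h1 h2 h3 h4; case: eqP => e /=.
  by rewrite e; congr pair; lia.
by congr pair; lia.
Qed.

Lemma path_word_last s : last (m, 0) (path_points mu (path_word s)) == (0, n).
Proof.
rewrite /mu /m path_last path_word_pt // /height (height_end hla hR) add0n.
by rewrite addKn.
Qed.

Lemma path_word_separating s : separating_path mu R s (path_word s).
Proof.
apply/(separating_height hla hR hmu (path_word_last s)) => t ht.
by rewrite path_word_pt.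
Qed.

Lemma separating_unique s (w : (m + n).-tuple bool) :
  separating_path mu R s w -> w = path_word s.
Proof.
move=> hw; have hl : last (m, 0) (path_points mu w) == (0, n) by case/and3P: hw.
have hh := (separating_height hla hR hmu hl s).1 hw.
apply: val_inj; apply: (eq_from_nth (x0 := false)); rewrite ?size_tuple // => t ht.
rewrite [RHS]nth_mkseq // -[height s t.+1]hh // -[height s t]hh; last exact: ltnW.
have := count_take_le negb t.+1 w; rewrite (north_count hla hmu hl) !ptE /=.
rewrite (take_nth false) ?size_tuple // -cats1 count_cat /= addn0.
rewrite -/mu -/m; move: (count negb (take t w)) => c.
case: (nth false w t) => /= h; apply/esym; first by rewrite addn0 eqxx.
by apply/negbTE/eqP; lia.
Qed.

Lemma separating_exists_unique s :
  exists! w : (size mu + head 0 mu).-tuple bool, separating_path mu R s w.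
Proof.
exists (path_word s); split; first exact: path_word_separating.
by move=> w /separating_unique.
Qed.

Lemma sep_path_pointsE s : sep_path_points mu R s =
  mkseq (fun t => (height s t, height s t + t - m)) (m + n).+1.
Proof.
rewrite /sep_path_points; case: pickP => [w /separating_unique -> |/(_ (path_word s))].
  rewrite /mu path_pointsE size_tuple; apply/eq_in_map => t; rewrite mem_iota => ht.
  by rewrite path_word_pt //; lia.
by rewrite path_word_separating.
Qed.

End PathExistence.

(** * South-east chains and the image of Phi *)

(** For R in [plane] this is an excited diagram of mu in la: each box of mu slides R steps down its
    diagonal. *)
Definition excited (mu : seq nat) (R : nat -> nat -> nat) : pred (nat * nat) :=
  fun b => has (fun c => b == (c.1 + R c.1 c.2, c.2 + R c.1 c.2)) (boxes mu).

Lemma excitedP mu R b : reflect (exists i j, (i, j) \in boxes mu /\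
  b = (i + R i j, j + R i j)) (excited mu R b).
Proof.
apply: (iffP hasP) => [[[i j] h /eqP ->]|[i [j [h ->]]]]; first by exists i, j.
by exists (i, j).
Qed.

Lemma se_trans : transitive se_step.
Proof. by move=> ? ? ? /=; rewrite /se_step; lia. Qed.

Lemma se_chain_span (b : nat * nat) c : sorted se_step (b :: c) ->
  b.1 + size c <= (last b c).1 /\ b.2 + size c <= (last b c).2.
Proof.
elim: c b => [|b' c IH] b /=; first by rewrite !addn0.
by move=> /andP[/andP[h1 h2]] /IH; lia.
Qed.

Lemma se_chain_last b c x : sorted se_step (b :: c) -> x \in b :: c ->
  x.1 <= (last b c).1 /\ x.2 <= (last b c).2.
Proof.
case/lastP: c => [|c y] hs; first by rewrite inE => /eqP ->.
rewrite last_rcons -rcons_cons mem_rcons inE => /orP[/eqP -> //|hx].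
have : sorted se_step (rcons (b :: c) y) by [].
rewrite (sorted_rcons_all _ _ se_trans) => /andP[/allP/(_ x hx)/andP[h1 h2] _].
by split; apply: ltnW.
Qed.

Lemma se_is_chain la c : is_ferrers la -> sorted se_step c ->
  {subset c <= boxes la} -> is_chain se_step la c.
Proof.
move=> hla hs hc; split=> // b /and4P[/hasP[x1 h1 e1] /hasP[x2 h2 e2] /hasP[x3 h3 e3] /hasP[x4 h4 e4]].
case: c hs hc h1 h2 h3 h4 => // y c hs hc h1 h2 h3 h4.
have hl := hc _ (mem_last y c).
have [_ l2] := se_chain_last hs h4; have [l1 _] := se_chain_last hs h2.
have pos x : x \in y :: c -> 0 < x.1 /\ 0 < x.2.
  by move=> /hc; rewrite mem_boxes => /and3P[].
have [p1 _] := pos _ h1; have [_ p3] := pos _ h3.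
by apply: (boxes_closed hla hl); apply/andP; split;
   [exact: leq_trans p1 e1|exact: leq_trans e2 l1|exact: leq_trans p3 e3|exact: leq_trans e4 l2].
Qed.

Lemma se_chain_free_size la k G c : is_ferrers la -> chain_free se_step la k G ->
  sorted se_step c -> {subset c <= G} -> size c <= k.
Proof.
move=> hla [hG hno] hs hc; rewrite leqNgt; apply/negP => h; apply: hno.
have sub : {subset take k.+1 c <= c} by move=> b /mem_take.
exists (take k.+1 c); split.
- apply: se_is_chain => //; first exact: take_sorted.
  by move=> b /sub/hc/hG.
- by rewrite size_takel.
- by move=> b /sub/hc.
Qed.

Section SouthEast.
Variables (la : seq nat) (k : nat).
Hypothesis hla : is_ferrers la.

Let mu := inner k la.
Let m := size mu.
Let n := head 0 mu.

(** Here r is the number of boxes of the chain before b. They leave room for (i, j) to the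
    north-west of b, and the k - r boxes after b make (i + k, j + k) a box of la. *)
Lemma in_chainP (b : nat * nat) : b \in boxes la ->
  (exists c, [/\ is_chain se_step la c, size c = k.+1 & b \in c]) <->
  (exists i j r : nat, [/\ (i, j) \in boxes mu, r <= k & b = (i + r, j + r)]).
Proof.
move=> hb; split=> [[c [[c1 c2 c3] hsz hbc]]|[i [j [r [hij hr ->]]]]].
  case: b hb hbc => x y hb hbc.
  have [p1 [p2 e]] : exists p1 p2 : seq (nat * nat), c = p1 ++ (x, y) :: p2.
    by case/splitPr: hbc => p1 p2; exists p1, p2.
  subst c; clear hbc; rewrite size_cat /= in hsz.
  have [h1 h2] : x + size p2 <= (last (x, y) p2).1 /\ y + size p2 <= (last (x, y) p2).2.
    have : sorted se_step ((x, y) :: p2).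
      by apply: (subseq_sorted se_trans _ c2); apply: suffix_subseq.
    by move/se_chain_span.
  have [h3 h4] : size p1 < x /\ size p1 < y.
    case: p1 c1 c2 {c3 hsz} => [|z p1] c1 c2.
      by move: hb; rewrite mem_boxes => /and3P[].
    have : sorted se_step (z :: rcons p1 (x, y)).
      apply: (subseq_sorted se_trans _ c2); rewrite -rcons_cons -cat_rcons.
      exact: prefix_subseq.
    move/se_chain_span; rewrite last_rcons size_rcons /=.
    have := c1 z; rewrite inE eqxx => /(_ isT); rewrite mem_boxes => /and3P[z1 z2 _].
    move=> [e1 e2].
    by split; [apply: leq_trans e1|apply: leq_trans e2]; rewrite -(add1n (size p1).+1) leq_add2r.
  have hl : last (x, y) p2 \in boxes la.
    by apply: c1; rewrite mem_cat mem_last orbT.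
  exists (x - size p1), (y - size p1), (size p1); split.
  - rewrite mem_inner // !subn_gt0 h3 h4 /=.
    by apply: (boxes_closed hla hl) => /=; lia.
  - lia.
  - by congr pair; lia.
move: hij; rewrite mem_inner // => /and3P[hi hj hij].
exists (mkseq (fun u => (i + u, j + u)) k.+1); split.
- apply: se_is_chain => //.
    apply/(sortedP (0, 0)) => u; rewrite size_mkseq => hu.
    by rewrite !nth_mkseq //; [rewrite /se_step /=; lia|exact: ltnW].
  move=> x /mapP[u]; rewrite mem_iota => hu ->.
  by apply: (boxes_closed hla hij) => /=; lia.
- by rewrite size_mkseq.
- by apply/mapP; exists r; rewrite ?mem_iota //; lia.
Qed.

Lemma mem_chainless (b : nat * nat) : (b \in chainless_boxes la k) = (b \in boxes la) &&
  ~~ `[< exists i j r : nat, [/\ (i, j) \in boxes mu, r <= k & b = (i + r, j + r)] >].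
Proof.
rewrite mem_filter andbC; case hb : (b \in boxes la) => //=.
by congr (~~ _); apply: asbool_equiv_eq; apply: in_chainP.
Qed.

Section Plane.
Variable R : nat -> nat -> nat.
Hypothesis hR : plane la k R.

Let height := height la k R.

(** For s <= k the shift k - (k - s) in [path_marks] is s. *)
Definition marked (b : nat * nat) := exists s t, [/\ 1 <= s <= k, t <= m + n &
  b = (height s t + s, height s t + t - m + s)].

(** On one diagonal, a box of row i' has R < s exactly when i' is at most the height h of P_s there.
    So i' + R is less than h + s if R < s, and greater otherwise: marks and excited boxes never
    coincide. *)
Lemma marked_excited (i j r : nat) : (i, j) \in boxes mu -> r <= k ->
  marked (i + r, j + r) <-> ~~ excited mu R (i + r, j + r).
Proof.
move=> hij hr; have [hi hj him hjn] := mu_bounds hla hij.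
rewrite -/mu -/m -/n in him hjn.
split=> [[s [t [hs ht [e1 e2]]]]|hex].
  apply/negP => /excitedP[i' [j' [hij' [e3 e4]]]].
  have [hi' hj' him' hjn'] := mu_bounds hla hij'; rewrite -/mu -/m -/n in him' hjn'.
  have hge := height_ge hla hR s t; rewrite -/height -/mu -/m in hge.
  have et : t = j' + m - i' by lia.
  have hin := @height_inside la k hla R hR s i' t; rewrite -/mu -/m -/height hi' him' in hin.
  have := hin isT; rewrite /inside -/mu -/m (_ : i' + t <= m = false) /=; last by lia.
  rewrite (_ : i' + t - m = j') ?hij' /=; last by lia.
  by case: (ltnP (R i' j') s); lia.
pose t := j + m - i.
have ht : t <= m + n by lia.
pose x := i + r.
have [hno|hyes] := EM (exists2 s, 1 <= s <= k & height s t + s = x).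
  case: hno => s hs e; exists s, t; split=> //.
  have hge := height_ge hla hR s t; rewrite -/height -/mu -/m in hge.
  by rewrite e; congr pair; lia.
exfalso; move/negP: hex; apply.
(* An unmarked row x lies strictly between the marks of two consecutive labels s and s + 1, where s
   = 0 and s = k stand for a missing mark on one side. The box of row x - s on this diagonal then
   lies between the two paths, so its value is s and it slides to row x. *)
pose P s := (s <= k) && ((s == 0) || (height s t + s < x)).
have exP : exists s, P s by exists 0.
have ubP s : P s -> s <= k by case/andP.
case: (ex_maxnP exP ubP) => s /andP[hsk hs] hmax.
have hnext : s < k -> x < height s.+1 t + s.+1.
  move=> h; rewrite ltn_neqAle leqNgt; apply/andP; split.
    by apply/eqP => e; apply: hyes; exists s.+1.
  apply/negP => h'; have : P s.+1 by rewrite /P h h' orbT.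
  by move/hmax; rewrite ltnn.
have hsx : s < x by case/orP: hs => [/eqP ->|]; lia.
pose i' := x - s.
have hi'0 : 0 < i' by lia.
have hij_t : i + t = j + m by lia.
have hij' : (i', i' + t - m) \in boxes mu /\ 0 < i' + t - m.
  have hpos : 0 < i' + t - m.
    case/orP: hs => [/eqP e|hs]; first by lia.
    by have := height_ge hla hR s t; rewrite -/height -/mu -/m; lia.
  split=> //; move: hsk; rewrite leq_eqVlt => /orP[/eqP e|hlt].
    have := hij; rewrite !mem_inner // => /and3P[_ _ h]; rewrite hi'0 hpos /=.
    by apply: (boxes_closed hla h) => /=; lia.
  have hh := hnext hlt; have hle := height_le la k R s.+1 t.
  rewrite -/mu -/m -/height in hle.
  have := @height_inside la k hla R hR s.+1 i' t; rewrite -/mu -/m -/height hi'0.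
  rewrite (_ : i' <= m); last by lia.
  move=> /(_ isT); rewrite (_ : i' <= height s.+1 t); last by lia.
  by rewrite /inside -/mu -/m (_ : i' + t <= m = false) /=; [case/esym/andP|lia].
case: hij' => hij' hpos; have [_ _ him' _] := mu_bounds hla hij'.
rewrite -/mu -/m in him'.
have hRs : R i' (i' + t - m) = s.
  apply/eqP; rewrite eqn_leq; apply/andP; split.
    move: hsk; rewrite leq_eqVlt => /orP[/eqP ->|hlt].
      by have [hk _ _] := hR; apply: hk.
    have := @height_inside la k hla R hR s.+1 i' t; rewrite -/mu -/m -/height hi'0 him'.
    move=> /(_ isT); have := hnext hlt.
    rewrite /inside -/mu -/m (_ : i' + t <= m = false) /=; last by lia.
    by rewrite hij' /= ltnS => h <-; lia.
  case/orP: hs => [/eqP -> //|hs].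
  have := @height_inside la k hla R hR s i' t; rewrite -/mu -/m -/height hi'0 him'.
  move=> /(_ isT).
  rewrite /inside -/mu -/m (_ : i' + t <= m = false) /=; last by lia.
  rewrite hij' /= => e; rewrite leqNgt -e; lia.
apply/excitedP; exists i', (i' + t - m); split=> //; rewrite hRs.
by congr pair; lia.
Qed.

Lemma marked_in_la (b : nat * nat) : 0 < m -> marked b -> b \in boxes la.
Proof.
move=> hm [s [t [hs ht ->]]].
have hge := height_ge hla hR s t; have hle := height_le la k R s t.
rewrite -/height -/mu -/m in hge hle.
have hmu i j : (i, j) \in boxes mu -> (i + k, j + k) \in boxes la.
  by rewrite mem_inner // => /and3P[].
have hn : 0 < n by have [] := mu_bounds hla (mu_left hla (k := k) (i := m) _); rewrite ?hm ?leqnn.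
case: (posnP (height s t)) => h1.
  case: (posnP (height s t + t - m)) => h2.
    apply: (boxes_closed hla (hmu 1 1 _)) => /=; [apply: (mu_left hla)|lia|lia].
    by rewrite -/mu -/m; lia.
  apply: (boxes_closed hla (hmu 1 (height s t + t - m) _)) => /=; [apply: mu_top|lia|lia].
  by rewrite -/mu -/n; lia.
case: (posnP (height s t + t - m)) => h2.
  apply: (boxes_closed hla (hmu (height s t) 1 _)) => /=; [apply: (mu_left hla)|lia|lia].
  by rewrite -/mu -/m; lia.
apply: (boxes_closed hla (hmu (height s t) (height s t + t - m) _)) => /=; [|lia|lia].
have := @height_inside la k hla R hR s (height s t) t; rewrite -/mu -/m -/height leqnn h1 hle.
move=> /(_ isT); rewrite /inside -/mu -/m (_ : _ <= m = false) /=; last by lia.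
by move/esym/andP => [].
Qed.

End Plane.

Lemma Phi_mem F (b : nat * nat) : plane la k (Rtab la F) ->
  (b \in Phi la k F) = (b \in boxes la) && ~~ excited mu (Rtab la F) b.
Proof.
move=> hR; rewrite /Phi !inE /= mem_chainless.
have hmark : 0 < m -> (b \in path_marks la k F) <-> marked (Rtab la F) b.
  move=> hm; rewrite /path_marks -/mu.
  have -> : (if mu is [::] then [::] else
     [seq (v.1 + k - (k - s), v.2 + k - (k - s)) | s <- iota 1 k,
        v <- sep_path_points mu (Rtab la F) s]) =
     [seq (v.1 + k - (k - s), v.2 + k - (k - s)) | s <- iota 1 k,
        v <- sep_path_points mu (Rtab la F) s].
    by move: hm; rewrite /m; case: mu.
  split.
    case/allpairsPdep=> s [v [hs hv ->]]; move: hv hs.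
    rewrite sep_path_pointsE // => /mapP[t]; rewrite !mem_iota -/mu -/m -/n => ht -> hs.
    by exists s, t; split=> /=; [lia|lia|congr pair; lia].
  case=> s [t [hs ht ->]]; apply/allpairsPdep.
  exists s, (height la k (Rtab la F) s t, height la k (Rtab la F) s t + t - m).
  rewrite mem_iota sep_path_pointsE //; split; first by lia.
    by apply: map_f; rewrite mem_iota -/mu -/m -/n; lia.
  by congr pair => /=; lia.
have [h|hno] := EM (exists i j r : nat, [/\ (i, j) \in boxes mu, r <= k & b = (i + r, j + r)]).
  rewrite (asboolT h) /= andbF orbF; case: h => i [j [r [hij hr e]]].
  have hm : 0 < m by have [h1 _ h2 _] := mu_bounds hla hij; apply: leq_trans h1 h2.
  have hb : b \in boxes la.
    move: hij; rewrite mem_inner // e => /and3P[h1 h2 h3].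
    by apply: (boxes_closed hla h3) => /=; lia.
  rewrite hb /=; apply/idP/idP.
    by move/(hmark hm); rewrite e => /(marked_excited hR hij hr).
  by rewrite e => /(marked_excited hR hij hr); rewrite -e => /(hmark hm).
rewrite (asboolF hno) /= andbT.
have -> : excited mu (Rtab la F) b = false.
  apply/negP => /excitedP[i [j [hij e]]]; apply: hno; exists i, j, (Rtab la F i j).
  by split=> //; have [h _ _] := hR; apply: h.
rewrite andbT; case hb : (b \in boxes la); rewrite ?orbT ?orbF //.
apply/negP => hp; have hm : 0 < m.
  by move: hp; rewrite /path_marks -/mu /m; case: mu.
by have := marked_in_la hR hm ((hmark hm).1 hp); rewrite hb.
Qed.

End SouthEast.

(** * South-east fillings *)

(** The number of boxes of G on the diagonal of (x, y), from its start up to (x, y) included. *)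
Fixpoint diag (G : pred (nat * nat)) (x y : nat) : nat :=
  match x, y with
  | x'.+1, y'.+1 => diag G x' y' + G (x, y)
  | _, _ => 0
  end.

Lemma diag_chain G x y d : exists c, [/\ sorted se_step c,
  all (fun b => [&& G b, x < b.1, b.1 <= x + d, y < b.2 & b.2 <= y + d]) c &
  diag G x y + size c = diag G (x + d) (y + d)].
Proof.
elim: d => [|d [c [c1 c2 c3]]]; first by exists [::]; rewrite !addn0.
rewrite !addnS; case hG : (G ((x + d).+1, (y + d).+1)); last first.
  exists c; split=> //=; last by rewrite hG addn0.
  by apply: sub_all c2 => b /and5P[-> -> ? -> ?]; lia.
exists (rcons c ((x + d).+1, (y + d).+1)); split.
- rewrite (sorted_rcons_all _ _ se_trans) c1 andbT.
  by apply: sub_all c2 => b /and5P[_ _ ? _ ?]; rewrite /se_step /=; lia.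
- rewrite all_rcons /= hG /=; apply/andP; split; first by lia.
  by apply: sub_all c2 => b /and5P[-> -> ? -> ?]; lia.
- by rewrite size_rcons /= hG -c3; lia.
Qed.

Lemma diag_chain0 G x y : exists c, [/\ sorted se_step c,
  all (fun b => [&& G b, b.1 <= x & b.2 <= y]) c & size c = diag G x y].
Proof.
have [c [c1 c2 c3]] := diag_chain G (x - minn x y) (y - minn x y) (minn x y).
exists c; split=> //.
  by apply: sub_all c2 => b /and5P[-> _ ? _ ?]; lia.
move: c3; rewrite !subnK; [|exact: geq_minr|exact: geq_minl].
suff -> : diag G (x - minn x y) (y - minn x y) = 0 by [].
by case: (leqP x y) => h; [rewrite subnn|rewrite subnn; case: (x - y)].
Qed.

Lemma count_sub_in (T : eqType) (a b : pred T) s : {in s, subpred a b} ->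
  count a s <= count b s /\ (count a s = count b s -> {in s, a =1 b}).
Proof.
move=> h; have e : count a (filter b s) = count a s.
  rewrite count_filter; apply: eq_in_count => x /h /=.
  by case: (a x) => //= ->.
split; first by rewrite -e -(size_filter b) count_size.
move=> eab x hx; apply/idP/idP; first exact: h.
move=> hb; have : all a (filter b s) by rewrite all_count e eab size_filter.
by move/allP; apply; rewrite mem_filter hb.
Qed.

Section Fillings.
Variables (la : seq nat) (k : nat).
Hypothesis hla : is_ferrers la.

Let mu := inner k la.

Lemma mu_la (i j r : nat) : (i, j) \in boxes mu -> r <= k -> (i + r, j + r) \in boxes la.
Proof.
rewrite mem_inner // => /and3P[h1 h2 h3] hr.
by apply: (boxes_closed hla h3) => /=; lia.
Qed.

Lemma diag_mono (R : nat -> nat -> nat) (i j d : nat) :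
  (forall i j, (i, j) \in boxes mu -> (i.+1, j.+1) \in boxes mu -> R i j <= R i.+1 j.+1) ->
  (i, j) \in boxes mu -> (i + d, j + d) \in boxes mu -> R i j <= R (i + d) (j + d).
Proof.
move=> hd hij; elim: d => [|d IH] h; first by rewrite !addn0.
have [hi hj] := boxes_pos hij.
have h' : (i + d, j + d) \in boxes mu by apply: (mu_closed hla h); lia.
by apply: leq_trans (IH h') _; rewrite !addnS; apply: hd; rewrite -?addnS.
Qed.

(** Two boxes of one diagonal cannot slide to the same place, as R increases weakly along it; so no
    box is lost. *)
Lemma excited_count (R : nat -> nat -> nat) :
  (forall i j, (i, j) \in boxes mu -> R i j <= k) ->
  (forall i j, (i, j) \in boxes mu -> (i.+1, j.+1) \in boxes mu -> R i j <= R i.+1 j.+1) ->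
  count (excited mu R) (boxes la) = size (boxes mu).
Proof.
move=> hk hd; pose f (c : nat * nat) := (c.1 + R c.1 c.2, c.2 + R c.1 c.2).
rewrite -size_filter -(size_map f (boxes mu)); apply: perm_size; apply: uniq_perm.
- by rewrite filter_uniq // boxes_uniq.
- rewrite map_inj_in_uniq ?boxes_uniq //.
  suff H (i j i' j' : nat) : (i, j) \in boxes mu -> (i', j') \in boxes mu ->
      i <= i' -> f (i, j) = f (i', j') -> (i, j) = (i', j').
    move=> [i j] [i' j'] h h' e; case: (leqP i i') => hi; first exact: H.
    by apply/esym/H => //; apply: ltnW.
  move=> h h' hi [e1 e2]; have [hj|hj] := leqP j j'; last by lia.
  have eij : i' = i + (i' - i) /\ j' = j + (i' - i) by lia.
  have := @diag_mono R i j (i' - i) hd h; rewrite -eij.1 -eij.2 => /(_ h') hle.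
  by congr pair; lia.
move=> b; rewrite mem_filter; apply/andP/mapP => [[/excitedP[i [j [h ->]]] _]|].
  by exists (i, j).
case=> -[i j] h ->; split; first by apply/excitedP; exists i, j.
by apply: mu_la => //; apply: hk.
Qed.

Section ChainFree.
Variable G : {fset nat * nat}.
Hypothesis hG : chain_free se_step la k G.

Let D := diag (fun b => b \in G).

Lemma diag_le x y : D x y <= k.
Proof.
have [c [c1 c2 e]] := diag_chain0 (fun b => b \in G) x y.
by rewrite /D -e; apply: (se_chain_free_size hla hG c1) => b /(allP c2) /and3P[].
Qed.

(* the number of boxes of G before the zero of the diagonal of (i, j) which has
   the same rank on the diagonal as (i, j) *)
Definition shift (i j : nat) : nat :=
  find (fun r => D (i + r) (j + r) <= r) (iota 0 k.+1).

(** The condition D <= r says that the diagonal has at least min(i, j) zeros up to (i + r, j + r).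
    At the first such r the box itself is a zero: with a one there, D would already be at most r - 1
    one step earlier. *)
Lemma shiftP i j r : 0 < i -> 0 < j -> r <= k -> D (i + r) (j + r) <= r ->
  [/\ shift i j <= r, (i + shift i j, j + shift i j) \notin G &
      D (i + shift i j) (j + shift i j) <= shift i j].
Proof.
move=> hi hj hr hD; pose P r := D (i + r) (j + r) <= r.
have hbef r' : r' < shift i j -> r' < D (i + r') (j + r').
  move=> h; have := before_find 0 h; rewrite nth_iota ?add0n => [h'|].
    by rewrite ltnNge h'.
  by rewrite -(size_iota 0 k.+1) (leq_trans h) // find_size.
have hle : shift i j <= r.
  by rewrite leqNgt; apply/negP => /hbef; rewrite ltnNge hD.
have hP : D (i + shift i j) (j + shift i j) <= shift i j.
  have hhas : has P (iota 0 k.+1) by apply/hasP; exists r; rewrite // mem_iota.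
  have := nth_find 0 hhas; rewrite -/(shift i j) nth_iota ?add0n //.
  by rewrite -(size_iota 0 k.+1) -has_find.
split=> //; apply/negP => hz.
have e : D (i + shift i j) (j + shift i j) =
    D (i + shift i j).-1 (j + shift i j).-1 + 1.
  by clear P hD; case: i j hi hj hbef hle hP hz => // i [//|j] _ _ _ _ _ hz; rewrite !addSn /D /= -!addSn hz.
case es : (shift i j) => [|r0]; first by rewrite es in e hP; lia.
have := hbef r0; rewrite es ltnSn => /(_ isT).
by rewrite es in e hP; move: e hP; rewrite !addnS /=; lia.
Qed.

Lemma diag_S x y : D x y <= D x.+1 y.+1.
Proof. by rewrite {2}/D /= leq_addr. Qed.

Lemma shift_le i j : 0 < i -> 0 < j -> shift i j <= k.
Proof. by move=> hi hj; have [] := shiftP hi hj (leqnn k) (diag_le _ _). Qed.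

Lemma shift_diag i j : 0 < i -> 0 < j -> shift i j <= shift i.+1 j.+1.
Proof.
move=> hi hj; have [_ _ h] := shiftP (ltn0Sn i) (ltn0Sn j) (leqnn k) (diag_le _ _).
have [] // := shiftP hi hj (shift_le (ltn0Sn i) (ltn0Sn j)).
by apply: leq_trans h; rewrite !addSn; apply: diag_S.
Qed.

Lemma shift_diag_add i j d : 0 < i -> 0 < j -> shift i j <= shift (i + d) (j + d).
Proof.
move=> hi hj; elim: d => [|d IH]; first by rewrite !addn0.
by rewrite !addnS; apply: leq_trans IH (shift_diag _ _); lia.
Qed.

Lemma excited_notin b : excited mu shift b -> b \notin G.
Proof.
by move=> /excitedP[i [j [/boxes_pos[hi hj] ->]]];
   have [] := shiftP hi hj (leqnn k) (diag_le _ _).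
Qed.

Lemma filling_complement : {in boxes la, subpred (mem G) (predC (excited mu shift))}.
Proof. by move=> b _ hb; apply/negP => /excited_notin; rewrite (hb : b \in G). Qed.

Lemma complement_count : count (predC (excited mu shift)) (boxes la) + size (boxes mu) =
  size (boxes la).
Proof.
rewrite addnC -(@excited_count shift) ?count_predC //.
  by move=> i j /boxes_pos[hi hj]; apply: shift_le.
by move=> i j /boxes_pos[hi hj] _; apply: shift_diag.
Qed.

Lemma se_card : #|` G| + size (boxes mu) <= size (boxes la).
Proof.
rewrite (card_fset_boxes hG.1) -complement_count leq_add2r.
exact: (count_sub_in filling_complement).1.
Qed.

Section Maximal.
Hypothesis hcard : #|` G| + size (boxes mu) = size (boxes la).

Lemma filling_excited b : b \in boxes la -> (b \in G) = ~~ excited mu shift b.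
Proof.
move=> hb; apply: (count_sub_in filling_complement).2 => //; apply/eqP.
by rewrite -(eqn_add2r (size (boxes mu))) complement_count -hcard (card_fset_boxes hG.1).
Qed.

(* otherwise the diagonal would have a zero beyond those counted by excited *)
Lemma diag_full i j : (i, j) \in boxes mu -> (i.+1, j.+1) \notin boxes mu ->
  k <= D (i + k) (j + k).
Proof.
move=> hij hno; have [hi hj] := boxes_pos hij; rewrite leqNgt; apply/negP => hlt.
have hD : D (i.+1 + k.-1) (j.+1 + k.-1) <= k.-1.
  by rewrite !addSnnS prednK; lia.
have [h1 h2 h3] := shiftP (ltn0Sn i) (ltn0Sn j) (leq_pred k) hD.
set r := shift i.+1 j.+1 in h1 h2 h3.
have hb : (i.+1 + r, j.+1 + r) \in boxes la.
  by apply: (boxes_closed hla (mu_la hij (leqnn k))) => /=; lia.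
move: h2; rewrite filling_excited // negbK => /excitedP[i' [j' [hij' [e1 e2]]]].
have [hi' hj'] := boxes_pos hij'.
have [hle|hlt'] := leqP i' i.
  have := shift_diag_add (i - i') hi' hj'.
  rewrite (_ : i' + (i - i') = i) 1?(_ : j' + (i - i') = j); [|lia|lia].
  by have := shift_diag hi hj; rewrite -/r; lia.
by case/negP: hno; apply: (mu_closed hla hij'); lia.
Qed.

Lemma diag_end i j : (i, j) \in boxes mu -> exists d,
  (i + d, j + d) \in boxes mu /\ (i + d.+1, j + d.+1) \notin boxes mu.
Proof.
move=> hij; pose P d := (i + d, j + d) \in boxes mu.
have exP : exists d, P d by exists 0; rewrite /P !addn0.
have ubP d : P d -> d <= size mu by move=> /(mu_bounds hla)[_ _ h _]; apply: leq_trans h; apply: leq_addl.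
case: (ex_maxnP exP ubP) => d hd hmax; exists d; split=> //.
by apply/negP => /hmax; rewrite ltnn.
Qed.

(** Suppose r = [shift i' j'] were smaller than [shift i j]. The diagonal of (i, j) then has more
    than r ones up to (i + r, j + r). The other diagonal has at most r ones up to (i' + r, j' + r),
    hence at least k - r later ones by [diag_full]. Joined together they form a chain longer than
    k. *)
Lemma shift_mono i j i' j' : (i, j) \in boxes mu -> (i', j') \in boxes mu ->
  i <= i' -> j <= j' -> shift i j <= shift i' j'.
Proof.
move=> hij hij' hi hj; have [hi0 hj0] := boxes_pos hij; have [hi0' hj0'] := boxes_pos hij'.
have [hk _ hD'] := shiftP hi0' hj0' (leqnn k) (diag_le _ _).
set r := shift i' j' in hk hD' *.
rewrite leqNgt; apply/negP => hlt.
have hD : r < D (i + r) (j + r).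
  rewrite ltnNge; apply/negP => hle.
  by have [h _ _] := shiftP hi0 hj0 hk hle; lia.
have [d [hd hno]] := diag_end hij'; rewrite !addnS in hno.
have hfull := diag_full hd hno.
have [c [c1 c2 c3]] := diag_chain0 (fun b => b \in G) (i + r) (j + r).
have [c' [c1' c2' c3']] := diag_chain (fun b => b \in G) (i' + r) (j' + r) (d + (k - r)).
have e x : x + r + (d + (k - r)) = x + d + k by lia.
rewrite !e in c3'; have : size (c ++ c') <= k.
  apply: (se_chain_free_size hla hG).
    rewrite (sorted_pairwise se_trans) pairwise_cat -!(sorted_pairwise se_trans) c1 c1' !andbT.
    apply/allrelP => x y /(allP c2) /and3P[_ h1 h2] /(allP c2') /and5P[_ h3 _ h4 _].
    by rewrite /se_step; lia.
  move=> x; rewrite mem_cat => /orP[/(allP c2) /and3P[]//|/(allP c2') /and5P[]//].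
rewrite size_cat (c3 : size c = D (i + r) (j + r)).
have {}c3' : D (i' + r) (j' + r) + size c' = D (i' + d + k) (j' + d + k) := c3'.
lia.
Qed.

Lemma shift_plane : plane la k shift.
Proof.
split=> [i j /boxes_pos[hi hj]|i j h h'|i j h h']; first exact: shift_le.
  exact: shift_mono.
exact: shift_mono.
Qed.

End Maximal.
End ChainFree.

Definition plane_filling (R : nat -> nat -> nat) : {fset nat * nat} :=
  [fset b in [seq b <- boxes la | ~~ excited mu R b]]%fset.

Lemma mem_plane_filling R b :
  (b \in plane_filling R) = (b \in boxes la) && ~~ excited mu R b.
Proof. by rewrite !inE /= mem_filter andbC. Qed.

Section PlaneFilling.
Variable R : nat -> nat -> nat.
Hypothesis hR : plane la k R.

Lemma plane_card : #|` plane_filling R| + size (boxes mu) = size (boxes la).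
Proof.
rewrite (@card_fset_boxes la) => [|b]; last by rewrite mem_plane_filling => /andP[].
rewrite (eq_in_count (a2 := predC (excited mu R))) => [|b hb]; last first.
  by rewrite /= mem_plane_filling hb.
rewrite addnC -(@excited_count R) ?count_predC //; first by case: hR.
move=> i j h h'; apply: (plane_mono hla hR h'); have := boxes_pos h; lia.
Qed.

(* the marks of one path P_s are never strictly south-east of each other, and
   the paths are nested, so that the label s increases along a chain *)
Lemma marked_lt s t s' t' : 1 <= s <= k -> 1 <= s' <= k ->
  let h := height la k R in
  se_step (h s t + s, h s t + t - size mu + s) (h s' t' + s', h s' t' + t' - size mu + s') ->
  s < s'.
Proof.
move=> hs hs' h /andP[/= h1 h2]; rewrite ltnNge; apply/negP => hss.
have hge := height_ge hla hR s t; have hge' := height_ge hla hR s' t'.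
have hle' := height_le la k R s' t'; rewrite -/h -/mu in hge hge' hle'.
have : inside la k R s (h s t).+1 t.
  apply: (@inside_NW la k hla R hR s (h s' t') (h s t).+1 t'); [lia|lia|].
  have hin : inside la k R s' (h s' t') t'.
    by rewrite -height_inside // -/h ?leqnn // hle' andbT; lia.
  move: hin; rewrite /inside => /orP[->//|/andP[-> hlt]]; rewrite (leq_trans hlt hss).
  by rewrite orbT.
rewrite -height_inside //; first by rewrite -/h ltnn.
by rewrite -/mu; lia.
Qed.

(** Boxes of a chain of length k + 1 are not among the chainless ones, so all of them are marked.
    Their labels lie between 1 and k and strictly increase by [marked_lt], which is impossible for k
    + 1 boxes. *)
Lemma plane_chain_free : chain_free se_step la k (plane_filling R).
Proof.
split; first by move=> b; rewrite mem_plane_filling => /andP[].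
move=> [c [hc hsz hF]].
have hmark b : b \in c -> marked la k R b.
  move=> hb; have := hF b hb; rewrite mem_plane_filling => /andP[hbla hex].
  have := (@in_chainP la k hla b hbla).1 => /(_ (ex_intro _ c (And3 hc hsz hb))).
  case=> i [j [r [hij hr e]]]; rewrite e in hex *.
  exact: (marked_excited hla hR hij hr).2.
case: hc => _ hs _.
have H (b : nat * nat) d s t : sorted se_step (b :: d) -> {in b :: d, forall x, marked la k R x} ->
    1 <= s <= k -> b = (height la k R s t + s, height la k R s t + t - size mu + s) ->
    s + size d <= k.
  elim: d b s t => [|b' d IH] b s t; first by rewrite addn0 => _ _ /andP[].
  move=> /= /andP[hbb' hd] hm hs0 hb.
  have hm' : {in b' :: d, forall x, marked la k R x}.
    by move=> x hx; apply: hm; rewrite inE hx orbT.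
  have [s' [t' [hs' _ hb']]] := hm' b' (mem_head _ _).
  have := IH b' s' t' hd hm' hs' hb'; rewrite hb hb' in hbb'.
  by have := marked_lt hs0 hs' hbb'; lia.
case: c hs hsz hF hmark => // b d hs [hsz] _ hmark.
have [s [t [hs0 _ hb]]] := hmark b (mem_head _ _).
by have := H b d s t hs hmark hs0 hb; lia.
Qed.

Lemma plane_F_SE : F_SE la k (plane_filling R).
Proof.
split; first exact: plane_chain_free.
by move=> G hG; rewrite -(leq_add2r (size (boxes mu))) plane_card; apply: se_card.
Qed.

End PlaneFilling.

Lemma F_SE_card G : F_SE la k G -> #|` G| + size (boxes mu) = size (boxes la).
Proof.
(* The zero array gives a filling that attains the bound of [se_card]. *)
case=> hG hmax; have h0 : plane la k (fun _ _ => 0) by [].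
apply/eqP; rewrite eqn_leq se_card //= -(plane_card h0) leq_add2r.
exact/hmax/plane_chain_free.
Qed.

Lemma F_SE_plane G : F_SE la k G ->
  exists2 R, plane la k R & G = plane_filling R.
Proof.
move=> hG; have hc := F_SE_card hG; exists (shift G); first exact: (shift_plane hG.1 hc).
apply/fsetP => b; rewrite mem_plane_filling; case hb : (b \in boxes la) => /=.
  exact: (filling_excited hG.1 hc).
by apply/negP => /hG.1.1; rewrite hb.
Qed.

Lemma plane_filling_inj R R' : plane la k R -> plane la k R' ->
  plane_filling R = plane_filling R' ->
  forall i j, (i, j) \in boxes mu -> R i j = R' i j.
Proof.
(* The slid box (i, j) of S is also the slid box of some (i', j') for S'. If i <= i', monotonicity
   of S' gives the inequality. If i' < i, both arrays agree at (i', j') and two boxes of one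
   diagonal would slide to the same place under S. *)
have key S S' : plane la k S -> plane la k S' -> plane_filling S = plane_filling S' ->
    forall i j : nat, (i, j) \in boxes mu ->
    (forall d, 0 < d -> d < i -> d < j -> S (i - d) (j - d) = S' (i - d) (j - d)) ->
    S' i j <= S i j.
  move=> hS hS' e i j hij IH; have [hSk _ _] := hS.
  have hin : (i + S i j, j + S i j) \in boxes la by apply: mu_la => //; apply: hSk.
  have : (i + S i j, j + S i j) \notin plane_filling S'.
    by rewrite -e mem_plane_filling hin /= negbK; apply/excitedP; exists i, j.
  rewrite mem_plane_filling hin /= negbK => /excitedP[i' [j' [hij' [e1 e2]]]].
  have [hi hj] := boxes_pos hij; have [hi' hj'] := boxes_pos hij'.
  have [hle|hlt] := leqP i i'.
    have := plane_mono hla hS' hij' (i' := i) (j' := j); lia.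
  have := IH (i - i'); rewrite (_ : i - (i - i') = i'); last by lia.
  rewrite (_ : j - (i - i') = j'); last by lia.
  have := plane_mono hla hS hij (i' := i') (j' := j'); lia.
move=> hR hR' e i j; have [n] := ubnP i; elim: n i j => // n IH i j hn hij.
have hd d : 0 < d -> d < i -> d < j -> R (i - d) (j - d) = R' (i - d) (j - d).
  move=> d0 d1 d2; apply: IH; first by lia.
  by apply: (mu_closed hla hij); lia.
apply/eqP; rewrite eqn_leq; apply/andP; split.
  by apply: (key R' R) => // d d0 d1 d2; rewrite hd.
exact: (key R R').
Qed.

End Fillings.

Theorem theorem1p2 (la : seq nat) (k : nat) (hla : is_ferrers la)
    (hk : 0 < k) :
  (forall F : {fset nat * nat}, F_NE la k F -> Phi_well_defined la k F) /\
  set_bij (F_NE la k) (F_SE la k) (Phi la k).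
Proof.
have hplane F : F_NE la k F -> plane la k (Rtab la F).
  move=> hF; have [_ _ [h1 h2 h3]] := filling_tableau hla hF.
  by split=> // i j /h1[].
have hPhi F : F_NE la k F -> Phi la k F = plane_filling la k (Rtab la F).
  move=> hF; apply/fsetP => b; rewrite mem_plane_filling.
  by apply: Phi_mem => //; apply: hplane.
split=> [F hF|].
  have [h1 h2 h3] := filling_tableau hla hF; split=> // hmu s _.
  apply: (separating_exists_unique hla (hplane _ hF)).
  by case: (inner k la) hmu.
split.
- by move=> F hF; rewrite hPhi //; apply: plane_F_SE => //; apply: hplane.
- move=> F G; rewrite !in_setE => hF hG; rewrite !hPhi // => e.
  by apply: (filling_inj hla hF hG); apply: plane_filling_inj e => //; apply: hplane.
- move=> G /(F_SE_plane hla)[R [hRk hRr hRc] ->].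
  have [F hF hFR] := filling_surj hla hRk hRr hRc.
  exists F => //; rewrite hPhi //; apply/fsetP => b; rewrite !mem_plane_filling.
  congr (_ && ~~ _); apply/excitedP/excitedP => -[i [j [h ->]]]; exists i, j.
    by rewrite hFR.
  by rewrite hFR.
Qed.
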